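(* Let $A$ and $V$ be bounded self-adjoint operators on a separable Hilbert space $\mathfrak{H}$. Suppose that $\mathrm{spec}(A)=\sigma\cup\Sigma$ with $\mathrm{dist}(\sigma,\Sigma)=d>0$. Let $P=\mathsf{E}_A(\sigma)$ and $Q=\mathsf{E}_{A+V}(U_{d/2}(\sigma))$. Suppose that either (i) $\|V\|<\frac{2}{2+\pi}\,d$, or (ii) $\|V\|<\frac12 d$ and at least one of the following holds: $\mathrm{conv.hull}(\sigma)\cap\Sigma=\emptyset$ or $\mathrm{conv.hull}(\Sigma)\cap\sigma=\emptyset$. Then $\|P-Q\|<1$.
   Context: $\mathrm{spec}(A)$ denotes the spectrum of $A$. For a Borel set $\Delta\subset\mathbb{R}$ and a bounded self-adjoint operator $B$, $\mathsf{E}_B(\Delta)$ denotes the spectral projection of $B$ corresponding to $\Delta$. For nonempty $S,T\subset\mathbb{R}$, $\mathrm{dist}(S,T)=\inf\{|s-t| : s\in S, t\in T\}$. $U_\varepsilon(\sigma)$, $\varepsilon>0$, is the open $\varepsilon$-neighborhood of $\sigma$ in $\mathbb{R}$, i.e. $U_\varepsilon(\sigma)=\{\lambda\in\mathbb{R} : \mathrm{dist}(\{\lambda\},\sigma)<\varepsilon\}$. $\mathrm{conv.hull}(S)$ denotes the convex hull of $S\subset\mathbb{R}$. $\|\cdot\|$ is the operator norm. *)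

(* Defs.v *)
From HB Require Import structures.
From mathcomp Require Import all_boot all_order all_algebra.
From mathcomp Require Import all_classical all_reals all_analysis.
From mathcomp Require Import complex.

Set Implicit Arguments.
Unset Strict Implicit.
Unset Printing Implicit Defensive.

Import Order.TTheory GRing.Theory Num.Theory.
Import numFieldNormedType.Exports.

Local Open Scope classical_set_scope.
Local Open Scope ring_scope.
Local Open Scope complex_scope.

(* A Hilbert space is a complete normed space over R[i] whose norm comes from
   an inner product (linear in the first argument). *)
Definition norm_from_dot (R : realType) (H : normedModType R[i])
    (dot : {dot H for Num.conj}) : Prop :=
  forall x : H, `|x| ^+ 2 = dot x x.

Definition separable (T : topologicalType) : Prop :=
  exists2 D : set T, countable D & dense D.

Definition bounded_selfadjoint (R : realType) (H : normedModType R[i])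
    (dot : {dot H for Num.conj}) (A : {linear H -> H}) : Prop :=
  continuous A /\ forall x y : H, dot (A x) y = dot x (A y).

(* Norms in a normed space over R[i] are R[i]-valued (with zero imaginary
   part), hence the real part. *)
Definition opnorm (R : realType) (H : normedModType R[i]) (T : H -> H) : R :=
  sup [set complex.Re `|T x| | x in [set x : H | `|x| <= 1]].

Definition resolvent_set (R : realType) (H : normedModType R[i])
    (A : {linear H -> H}) : set R[i] :=
  [set z | exists B : {linear H -> H},
    [/\ continuous B,
        forall x, B (A x - z *: x) = x &
        forall x, A (B x) - z *: B x = x]].

Definition spec (R : realType) (H : normedModType R[i])
    (A : {linear H -> H}) : set R[i] := ~` resolvent_set A.

Definition orthogonal_projection (R : realType) (H : normedModType R[i])
    (dot : {dot H for Num.conj}) (P : {linear H -> H}) : Prop :=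
  (forall x, P (P x) = P x) /\ (forall x y, dot (P x) y = dot x (P y)).

(* The values of E on non-Borel sets are irrelevant. *)
Definition projection_valued_measure (R : realType) (H : normedModType R[i])
    (dot : {dot H for Num.conj}) (E : set R -> {linear H -> H}) : Prop :=
  [/\ forall D, measurable D -> orthogonal_projection dot (E D),
      forall x, E setT x = x,
      forall D1 D2, measurable D1 -> measurable D2 ->
        forall x, E (D1 `&` D2) x = E D1 (E D2 x) &
      forall F : (set R)^nat,
        (forall i, measurable (F i)) -> trivIset setT F ->
        forall x, (fun n => \sum_(i < n) E (F i) x) @ \oo -->
                  E (\bigcup_i F i) x].

(* E is the spectral measure of B, that is B = \int t dE(t), the integral being
   taken weakly: <B x, x> is the integral of t against the finite positive
   measure mu : D |-> <E(D) x, x>.  By the spectral theorem, a bounded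
   self-adjoint B has exactly one such E (on Borel sets). *)
Definition spectral_measure (R : realType) (H : normedModType R[i])
    (dot : {dot H for Num.conj}) (B : {linear H -> H})
    (E : set R -> {linear H -> H}) : Prop :=
  projection_valued_measure dot E /\
  forall x : H, exists mu : {measure set R -> \bar R},
    [/\ forall D, measurable D -> (mu D = (complex.Re (dot (E D x) x))%:E)%E,
        mu.-integrable setT (fun t : R => t%:E) &
        dot (B x) x = (Rintegral mu setT (fun t : R => t))%:C].

(* P = E_B(D). *)
Definition spectral_projection (R : realType) (H : normedModType R[i])
    (dot : {dot H for Num.conj}) (B : {linear H -> H}) (D : set R)
    (P : {linear H -> H}) : Prop :=
  exists2 E : set R -> {linear H -> H},
    spectral_measure dot B E & forall x, P x = E D x.

(* Meant for nonempty S and T (inf set0 = 0 otherwise). *)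
Definition dist (R : realType) (S T : set R) : R :=
  inf [set `|s - t| | s in S & t in T].

(* U_eps(S), for nonempty S. *)
Definition nbhd (R : realType) (eps : R) (S : set R) : set R :=
  [set t | dist [set t] S < eps].

Definition conv_hull (R : realType) (S : set R) : set R :=
  smallest (fun C : set R => convex_set (C : set R^o)) S.

(* Main.v *)
Require Import Defs.
From HB Require Import structures.
From mathcomp Require Import all_boot all_order all_algebra.
From mathcomp Require Import all_classical all_reals all_analysis.
From mathcomp Require Import measurable_realfun complex.
From mathcomp Require Import ring lra zify.
Set Implicit Arguments.
Unset Strict Implicit.
Unset Printing Implicit Defensive.
Import Order.TTheory GRing.Theory Num.Theory.
Import numFieldNormedType.Exports.
Local Open Scope classical_set_scope.
Local Open Scope ring_scope.
Local Open Scope complex_scope.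

(** Write [B = A + V], [v] for the norm of [V], and [P], [Q] for the two spectral
    projections.  In both cases [v < d / 2].  A perturbation of norm [v] moves
    the spectrum by at most [v] (lemma [perturbed_support]), so that [1 - Q] is
    the spectral projection of [B] for a set at distance at least [d - v] from
    [sigma], and [Q] that for a set at distance at least [d - v] from [Sigma].
    A [sin Theta] theorem then bounds the norms of [P (1 - Q)] and [(1 - P) Q]
    by [c * v / (d - v)], where [c = pi / 2] in general and [c = 1] when one of
    the two sets lies in an interval and the other outside of it.  The
    hypotheses on [V] say exactly that this number is less than [1].  Finally
    [P - Q = P (1 - Q) - (1 - P) Q] is a difference of two operators with
    orthogonal ranges and orthogonal supports, so its norm is at most the larger
    of their norms (lemma [nrm_sub_projections]).

    The constant [1] is the theorem of Davis and Kahan ([davis_kahan]): compare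
    the norms of [A - c] and [B - c] on the two ranges, [c] being the centre of
    the interval.

    The constant [pi / 2] is the theorem of Bhatia, Davis and McIntosh
    ([bhatia_davis_mcintosh]).  Let [x] and [y] lie in the ranges of [F T] and
    [E S], where [E] and [F] are the spectral measures of [A] and [B] and the
    sets [S] and [T] have distance at least [delta].  The function
    [f th = <exp (- i th B) x, exp (- i th A) y>] has frequencies [t - s] with
    [t] in [T] and [s] in [S], hence none in [(- delta, delta)], and its
    derivative is bounded by [v |x| |y|].  The Bohr-Favard inequality says that
    such an [f] satisfies [|f 0| <= pi / (2 delta) * v |x| |y|].  To have
    trigonometric polynomials in place of almost periodic functions, [A] and
    [B] are first replaced by operators with eigenvalues on a lattice of mesh
    [h = delta / M]; this changes the derivative by [2 h |x| |y|] at most, and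
    [M] tends to infinity.

    The Bohr-Favard inequality ([bohr_favard], [bohr_favard_grid]) is proved on
    a fine grid of the circle.  Assume that [f] has no frequency below [N], has
    slopes at most [1], and exceeds at its origin the peak of the triangle wave
    with slopes [1] and [-1] and frequency [N].  On each of the [2 N] monotone
    pieces of the wave the difference [g] of [f] and the wave is monotone, and
    it is positive on the two pieces next to the origin, so [g] changes sign at
    most [2 N - 2] times.  Hence some trigonometric polynomial of degree at most
    [N - 1] has the sign of [g] everywhere, although [g], like [f] and the wave,
    is orthogonal to it. *)

(** * Trigonometric sums on a grid *)

Section TrigonometricPolynomials.
Variable R : realType.
Implicit Types (N K : nat).

Lemma sinD_2pi_int (x : R) (n : int) : sin (x + 2 * pi * n%:~R) = sin x.
Proof.
have pos (y : R) k : sin (y + 2 * pi * k%:R) = sin y.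
  rewrite -[RHS](periodicn (@sinD2pi R) k); congr (sin (_ + _)).
  by rewrite mulr_natr [2 * _]mulrC mulr_natr.
case: n => n; first exact: pos.
by rewrite NegzE mulrNz mulrN -(pos (x - _) n.+1) subrK.
Qed.

Lemma cosD_2pi_int (x : R) (n : int) : cos (x + 2 * pi * n%:~R) = cos x.
Proof. by rewrite -!sinDpihalf addrAC sinD_2pi_int. Qed.

Lemma sin_neq0 (x : R) : 0 < `|x| < pi -> sin x != 0.
Proof.
move=> x0p; have /lt0r_neq0 := sin_gt0_pi x0p.
by case: (ger0P x) => // _; rewrite sinN oppr_eq0.
Qed.

(** Multiplied by [2 * sin (a * pi / K)], the sum telescopes. *)
Lemma sum_cos_roots_of_unity K (a : int) (phi : R) : (0 < `|a| < K)%N ->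
  \sum_(m < K) cos (a%:~R * (2 * pi / K%:R * m%:R) + phi) = 0.
Proof.
move=> /andP[a0 aK]; have K0 : (0 : R) < K%:R by rewrite ltr0n; lia.
pose c : R := a%:~R * (pi / K%:R).
have sc : sin c != 0.
  apply: sin_neq0; rewrite normrM (gtr0_norm (divr_gt0 (pi_gt0 R) K0)).
  have -> : `|a%:~R| = (absz a)%:R :> R by rewrite -intr_norm -abszE pmulrn.
  apply/andP; split; first by rewrite mulr_gt0 ?ltr0n ?divr_gt0 ?pi_gt0.
  by rewrite mulrCA gtr_pMr ?pi_gt0// ltr_pdivrMr// mul1r ltr_nat.
apply: (mulfI (mulf_neq0 (lt0r_neq0 (ltr0Sn R 1)) sc)); rewrite mulr0 mulr_sumr.
pose u m := sin (2 * c * m%:R + phi - c).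
rewrite (eq_bigr (fun m : 'I_K => u m.+1 - u m)); last first.
  move=> m _; rewrite /u.
  have -> : 2 * c * m.+1%:R + phi - c = (2 * c * m%:R + phi) + c.
    by rewrite -addn1 natrD; ring.
  rewrite sinD sinB.
  have -> : a%:~R * (2 * pi / K%:R * m%:R) + phi = 2 * c * m%:R + phi.
    by rewrite /c; ring.
  ring.
rewrite -(big_mkord xpredT (fun m => u m.+1 - u m)) telescope_sumr// /u.
have -> : 2 * c * K%:R + phi - c = (2 * c * 0 + phi - c) + 2 * pi * a%:~R.
  by rewrite /c; field; rewrite lt0r_neq0.
by rewrite sinD_2pi_int subrr.
Qed.

(** A product of two half-angle sines is a trigonometric polynomial of degree
    one, so [2 q] of them form one of degree [q]; the factor [cos (p t + phi)]
    is there for the induction, which removes two sines at a time. *)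
Lemma orthogonal_prod_sin N K (g t : nat -> R) :
    (forall (p : int) phi, (`|p| < N)%N ->
       \sum_(m < K) g m * cos (p%:~R * t m + phi) = 0) ->
  forall (s : seq R) q (p : int) phi, size s = q.*2 -> (`|p| + q < N)%N ->
  \sum_(m < K) g m * (cos (p%:~R * t m + phi) *
                      \prod_(a <- s) sin ((t m - a) / 2)) = 0.
Proof.
move=> orth s q; elim: q s => [|q IH] s p phi.
  case: s => //= _; rewrite addn0 => /orth H; rewrite -[RHS](H phi).
  by apply: eq_bigr => m _; rewrite big_nil mulr1.
case: s => [|a [|b s]]//; rewrite doubleS => -[ss] pq.
have E (m : nat) : g m * (cos (p%:~R * t m + phi) *
            \prod_(a <- a :: b :: s) sin ((t m - a) / 2)) =
   cos ((b - a) / 2) / 2 * (g m * (cos (p%:~R * t m + phi) *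
            \prod_(a <- s) sin ((t m - a) / 2)))
 - 4^-1 * (g m * (cos ((p + 1)%:~R * t m + (phi - (a + b) / 2)) *
            \prod_(a <- s) sin ((t m - a) / 2)))
 - 4^-1 * (g m * (cos ((p - 1)%:~R * t m + (phi + (a + b) / 2)) *
            \prod_(a <- s) sin ((t m - a) / 2))).
  rewrite !big_cons; set W := \prod_(_ <- _) _.
  have -> : (p + 1)%:~R * t m + (phi - (a + b) / 2) =
            (p%:~R * t m + phi) + (t m - (a + b) / 2).
    by rewrite intrD; ring.
  have -> : (p - 1)%:~R * t m + (phi + (a + b) / 2) =
            (p%:~R * t m + phi) - (t m - (a + b) / 2).
    by rewrite intrB; ring.
  move: (p%:~R * t m + phi) => u.
  rewrite (cosD u) (cosB u).
  have -> : (b - a) / 2 = (t m - a) / 2 - (t m - b) / 2 by field.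
  have -> : t m - (a + b) / 2 = (t m - a) / 2 + (t m - b) / 2 by field.
  move: ((t m - a) / 2) ((t m - b) / 2) => x y.
  by rewrite cosB cosD; field.
under eq_bigr do rewrite E.
rewrite !sumrB -!mulr_sumr.
rewrite !IH ?mulr0 ?subr0//; lia.
Qed.

Lemma odd_sign_changes (b : nat -> bool) K :
  odd (\sum_(m < K) (b m != b m.+1))%N = b 0%N (+) b K.
Proof.
elim: K => [|K IH]; first by rewrite big_ord0 addbb.
by rewrite big_ord_recr oddD IH /= oddb; do 3!case: (b _).
Qed.

Lemma prod_signs (b : nat -> bool) i K : (i <= K)%N ->
  \prod_(i <= m < K) (-1) ^+ (b m != b m.+1) = (-1) ^+ (b i (+) b K) :> R.
Proof.
move=> iK; rewrite -(subnKC iK); elim: (_ - _)%N => [|j IH].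
  by rewrite addn0 big_geq// addbb.
rewrite addnS big_nat_recr ?leq_addr//= IH -signr_addb.
by congr (_ ^+ _); do 3!case: (b _).
Qed.

(** The product of the [sin ((t - a) / 2)] over these zeros [a] follows the
    sign pattern [b]: it changes sign half-way between consecutive points of the
    grid [h * m] exactly where [b] does. *)
Definition sign_change_zeros (b : nat -> bool) (h : R) K :=
  [seq (m%:R + 2^-1) * h | m <- iota 0 K & b m != b m.+1].

Lemma size_sign_change_zeros (b : nat -> bool) h K :
  size (sign_change_zeros b h K) = (\sum_(m < K) (b m != b m.+1))%N.
Proof.
rewrite size_map size_filter -sum1_count [LHS]big_mkcond.
rewrite -(big_mkord xpredT (fun m => nat_of_bool (b m != b m.+1))).
by rewrite /index_iota subn0; apply: eq_bigr => m _; case: (b m != _).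
Qed.

(** At [h * i] the factor of a zero is negative when the zero lies to the right,
    so the sign counts the changes of [b] between [i] and [K]. *)
Lemma sign_change_prod_gt0 (b : nat -> bool) (h : R) K i :
  0 < h -> h * K%:R <= 2 * pi -> (i < K)%N ->
  0 < (-1) ^+ (b i (+) b K) *
      \prod_(a <- sign_change_zeros b h K) sin ((h * i%:R - a) / 2).
Proof.
move=> h0 hK iK; rewrite -(prod_signs b (ltnW iK)).
rewrite big_map big_filter -[X in iota 0 X](subn0 K) -/(index_iota 0 K).
have sgnE : \prod_(i <= m < K) (-1) ^+ (b m != b m.+1) =
     \prod_(0 <= m < K | b m != b m.+1) (if (i <= m)%N then -1 else 1) :> R.
  rewrite [RHS]big_mkcond (big_cat_nat (leq0n i) (ltnW iK))/=.
  rewrite [X in _ = X * _]big_nat_cond [X in _ = X * _]big1 ?mul1r.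
    by apply: eq_big_nat => m /andP[im mK]; rewrite im; case: ifP.
  by move=> m; rewrite andbT => /= mi; case: ifP => // _; rewrite leqNgt mi.
rewrite sgnE -big_split/= big_nat_cond; apply: prodr_gt0 => m /andP[mK _].
have mK' : (m.+1%:R : R) <= K%:R by rewrite ler_nat; lia.
have iK' : (i.+1%:R : R) <= K%:R by rewrite ler_nat; lia.
have m0 : (0 : R) <= m%:R by [].
have i0 : (0 : R) <= i%:R by [].
rewrite -addn1 natrD in mK'; rewrite -addn1 natrD in iK'.
case: ifP => im.
  have im' : (i%:R : R) <= m%:R by rewrite ler_nat.
  rewrite mulN1r -sinN; apply: sin_gt0_pi; apply/andP; split; nra.
have im' : (m.+1%:R : R) <= i%:R by rewrite ler_nat; lia.
rewrite -addn1 natrD in im'.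
rewrite mul1r; apply: sin_gt0_pi; apply/andP; split; nra.
Qed.

End TrigonometricPolynomials.

(** * The Bohr-Favard inequality *)

Section BohrFavard.
Variable R : realType.

Lemma sum_blocks (M : nmodType) n k (F : nat -> M) :
  \sum_(m < n * k) F m = \sum_(q < n) \sum_(i < k) F (q * k + i)%N.
Proof.
elim: n => [|n IH]; first by rewrite !big_ord0.
rewrite big_ord_recr -IH /= -!(big_mkord xpredT F) mulSnr.
rewrite (big_cat_nat (n := (n * k)%N)) ?leq_addr//=; congr (_ + _).
rewrite -{1}[(n * k)%N]add0n big_addn addKn big_mkord.
by apply: eq_bigr => i _; rewrite addnC.
Qed.

(** A monotone boolean sequence changes at most once; the equation also locates
    the change from the end values. *)
Lemma changes_monotone (b : nat -> bool) p n :
  (forall i, (i < n)%N -> b (p + i)%N -> b (p + i).+1) ->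
  (\sum_(i < n) (b (p + i) != b (p + i).+1) + b p)%N = b (p + n)%N.
Proof.
elim: n => [|n IH] mono; first by rewrite big_ord0 addn0.
rewrite big_ord_recr/= addnAC IH => [|i /ltnW/mono//].
move: (mono n (ltnSn n)); rewrite addnS.
by case: (b (p + n)%N) => [/(_ isT)-> //|_]; case: (b _).
Qed.

(** Slopes [-1] and [1] on alternate blocks of length [r], starting at a peak of
    height [r / 2]. *)
Definition triangle_wave (r m : nat) : R :=
  (-1) ^+ (m %/ r)%N * (r%:R / 2 - (m %% r)%:R).

Lemma triangle_waveE r q i : (0 < r)%N -> (i <= r)%N ->
  triangle_wave r (q * r + i) = (-1) ^+ q * (r%:R / 2 - i%:R).
Proof.
move=> r0; rewrite leq_eqVlt => /orP[/eqP->|ir]; last first.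
  by rewrite /triangle_wave divnMDl// modnMDl divn_small// addn0 modn_small.
rewrite -mulSnr /triangle_wave mulnK// modnMl exprS subr0.
by move: ((-1) ^+ q) => e; field.
Qed.

(** On a circle of [N] periods, a frequency below [N] is either zero, and the
    two halves of a period cancel, or sums to zero over the translates of a
    point by the period. *)
Lemma triangle_wave_orthogonal N r (p : int) (phi : R) :
    (0 < r)%N -> (`|p| < N)%N ->
  \sum_(m < N * r.*2) triangle_wave r m *
     cos (p%:~R * (2 * pi / (N * r.*2)%:R * m%:R) + phi) = 0.
Proof.
move=> r0 pN; have N0 : N%:R != 0 :> R by rewrite pnatr_eq0; lia.
have rN0 : r%:R != 0 :> R by rewrite pnatr_eq0; lia.
have period q i : (i <= r)%N ->
    triangle_wave r (q * r.*2 + i) = r%:R / 2 - i%:R.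
  move=> ir; have -> : (q * r.*2 + i = q.*2 * r + i)%N by lia.
  by rewrite triangle_waveE// -mul2n exprM sqrrN !expr1n mul1r.
have period' q i : (i <= r)%N ->
    triangle_wave r (q * r.*2 + (r + i)) = - (r%:R / 2 - i%:R).
  move=> ir; have -> : (q * r.*2 + (r + i) = q.*2.+1 * r + i)%N by lia.
  by rewrite triangle_waveE// exprS -mul2n exprM sqrrN !expr1n mulr1 mulN1r.
rewrite (sum_blocks N r.*2 (fun m => triangle_wave r m *
  cos (p%:~R * (2 * pi / (N * r.*2)%:R * m%:R) + phi))).
have [p0|p0] := eqVneq p 0.
  apply: big1 => q _; rewrite -addnn big_split_ord/= -big_split/=.
  apply: big1 => i _; rewrite addnn period ?period' 1?ltnW// p0 !mul0r mulNr.
  by rewrite subrr.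
rewrite exchange_big/=; apply: big1 => i _.
have [c cE] : exists c, forall q, triangle_wave r (q * r.*2 + i) = c.
  have [ir|ir] := leqP i r; first by exists (r%:R / 2 - i%:R) => q; exact: period.
  exists (- (r%:R / 2 - (i - r)%:R)) => q.
  by rewrite -(period' q) ?subnKC 1?ltnW//; have := ltn_ord i; lia.
under eq_bigr do rewrite cE; rewrite -mulr_sumr.
rewrite -[RHS](mulr0 c); congr (c * _).
rewrite -[RHS](@sum_cos_roots_of_unity R N p
  (p%:~R * (2 * pi / (N * r.*2)%:R * i%:R) + phi)); last by lia.
apply: eq_bigr => q _; congr cos.
move: (nat_of_ord i) (nat_of_ord q) => i' q'; rewrite natrD !natrM -muln2 natrM.
by field; rewrite N0 rN0.
Qed.

(** Compare [f] with the triangle wave of slope [s] and count the sign changes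
    of the difference. *)
Lemma bohr_favard_grid N r (f : nat -> R) (s : R) : (0 < N)%N -> (0 < r)%N ->
    (forall (p : int) phi, (`|p| < N)%N ->
       \sum_(m < N * r.*2) f m *
         cos (p%:~R * (2 * pi / (N * r.*2)%:R * m%:R) + phi) = 0) ->
    (forall m, `|f m.+1 - f m| <= s) -> f (N * r.*2)%N = f 0%N ->
  f 0%N <= s * (r%:R / 2).
Proof.
move=> N0 r0 orth step fper; rewrite leNgt; apply/negP => f0.
set K := (N * r.*2)%N; have K0 : (0 < K)%N by rewrite /K; lia.
have KE : K = (N.*2 * r)%N by rewrite /K; lia.
pose g m := f m - s * triangle_wave r m.
have s0 : 0 <= s by apply: le_trans (step 0%N).
have waveS q i : (i < r)%N -> triangle_wave r (q * r + i).+1 =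
     triangle_wave r (q * r + i) - (-1) ^+ q.
  move=> ir; rewrite -addnS !triangle_waveE ?(ltnW ir)//.
  by rewrite -addn1 natrD; ring.
have gS q i : (i < r)%N -> 0 <= (-1) ^+ q * (g (q * r + i).+1 - g (q * r + i)%N).
  move=> ir; rewrite /g waveS//.
  have /ler_normlP[s1 s2] := step (q * r + i)%N.
  by rewrite -signr_odd; case: (odd q); rewrite ?expr0 ?expr1; nra.
pose b m := 0 <= g m.
have g0 : 0 < g 0%N.
  have := @triangle_waveE r 0 0 r0 (leq0n r).
  by rewrite /g mul1r subr0 subr_gt0 => ->.
have b0 : b 0%N.
  by rewrite /b ltW.
have bK : b K.
  rewrite /b /g fper KE -[(_ * r)%N]addn0 triangle_waveE//.
  by rewrite -mul2n exprM sqrrN !expr1n mul1r subr0 subr_ge0 ltW.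
(* the number of sign changes of g on the block q *)
pose c q := (\sum_(i < r) (b (q * r + i) != b (q * r + i).+1))%N.
have cE q : if odd q then (c q + ~~ b (q * r))%N = ~~ b (q.+1 * r)%N
            else (c q + b (q * r))%N = b (q.+1 * r)%N.
  rewrite mulSnr; case: ifP => oq; last first.
    apply: changes_monotone => i ir; rewrite /b.
    by have := gS q i ir; rewrite -signr_odd oq mul1r subr_ge0 => /[swap]; exact: le_trans.
  rewrite -(@changes_monotone (fun m => ~~ b m)); last first.
    move=> i ir; rewrite /b; apply: contra.
    have := gS q i ir; rewrite -signr_odd oq expr1 mulN1r oppr_ge0 subr_le0.
    by move=> /[swap]; exact: le_trans.
  by congr (_ + _)%N; apply: eq_bigr => i _; do 2!case: (b _).
have c1 q : (c q <= 1)%N.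
  by have := cE q; case: ifP => _; do 2!case: (b _); case: (c q) => // -[].
have c0 : c 0%N = 0%N.
  by have := cE 0%N; rewrite /= mul0n b0; case: (b _) => /=; lia.
have cl : c N.*2.-1 = 0%N.
  have := cE N.*2.-1; rewrite prednK ?double_gt0// -KE bK.
  rewrite -subn1 oddB ?double_gt0// odd_double/=; lia.
(* no change on the first and last blocks, where g is positive *)
have csum : (\sum_(q < N.*2) c q <= N.*2.-2)%N.
  have [M ME] : exists M, N.*2 = M.+2 by exists N.*2.-2; lia.
  rewrite ME /= in cl *; rewrite big_ord_recr big_ord_recl /= c0 cl addn0 add0n.
  by apply: leq_trans (leq_sum _ (fun i _ => c1 _)) _; rewrite sum1_card card_ord.
have [q qE qN] : exists2 q, (\sum_(m < K) (b m != b m.+1))%N = q.*2 & (q < N)%N.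
  have := odd_sign_changes b K; rewrite b0 bK /= => /negbT oddS.
  exists (\sum_(m < K) (b m != b m.+1))%N./2.
    by rewrite even_halfK.
  suff : (\sum_(m < K) (b m != b m.+1) <= N.*2.-2)%N by lia.
  rewrite KE (sum_blocks N.*2 r (fun m => nat_of_bool (b m != b m.+1))).
  exact: csum.
have h0 : 0 < 2 * pi / K%:R :> R by rewrite divr_gt0 ?mulr_gt0 ?pi_gt0 ?ltr0n.
have K0' : (K%:R : R) != 0 by rewrite pnatr_eq0 -lt0n.
set h := 2 * pi / K%:R in h0.
have hK : h * K%:R <= 2 * pi by rewrite /h divfK.
pose T m := \prod_(a <- sign_change_zeros b h K) sin ((h * m%:R - a) / 2).
have Tsgn m : (m < K)%N -> 0 < (-1) ^+ (~~ b m) * T m.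
  by move=> /(sign_change_prod_gt0 b h0 hK); rewrite bK addbT.
have gT m : (m < K)%N -> 0 <= g m * T m.
  move=> /Tsgn; rewrite /b; case: (leP 0 (g m)) => gm.
    by rewrite mul1r => /ltW; exact: mulr_ge0.
  by rewrite /= expr1 mulN1r oppr_gt0 => /ltW Tm; apply: mulr_le0 => //; exact: ltW.
have gT0 : 0 < g 0%N * T 0%N.
  have := Tsgn _ K0; rewrite b0 mul1r; exact: mulr_gt0.
have : \sum_(m < K) g m * T m = 0.
  rewrite -[RHS](@orthogonal_prod_sin R N K g (fun m => h * m%:R) _
     (sign_change_zeros b h K) q 0 0).
  - by apply: eq_bigr => m _; rewrite mul0r add0r cos0 mul1r.
  - move=> p phi pN; have E m y : g m * y = f m * y - s * (triangle_wave r m * y).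
      by rewrite /g; ring.
    under eq_bigr do rewrite E.
    by rewrite sumrB -mulr_sumr orth// triangle_wave_orthogonal// mulr0 subrr.
  - by rewrite size_sign_change_zeros.
  - by rewrite absz0.
move=> /psumr_eq0P H.
have := H (fun m _ => gT m (ltn_ord m)) (Ordinal K0) isT => /= E.
by rewrite E ltxx in gT0.
Qed.

Lemma sum_cos_cos_grid K (n p : int) (phi psi : R) :
    (0 < `|(n + p)%R| < K)%N -> (0 < `|(n - p)%R| < K)%N ->
  \sum_(m < K) cos (n%:~R * (2 * pi / K%:R * m%:R) + psi) *
     cos (p%:~R * (2 * pi / K%:R * m%:R) + phi) = 0.
Proof.
move=> nDp nBp.
have E (m : nat) : cos (n%:~R * (2 * pi / K%:R * m%:R) + psi) *
     cos (p%:~R * (2 * pi / K%:R * m%:R) + phi) =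
  2^-1 * cos ((n + p)%:~R * (2 * pi / K%:R * m%:R) + (psi + phi)) +
  2^-1 * cos ((n - p)%:~R * (2 * pi / K%:R * m%:R) + (psi - phi)).
  move: (2 * pi / K%:R * m%:R) => t; rewrite intrD intrB.
  have -> : (n%:~R + p%:~R) * t + (psi + phi) =
    (n%:~R * t + psi) + (p%:~R * t + phi) by ring.
  have -> : (n%:~R - p%:~R) * t + (psi - phi) =
    (n%:~R * t + psi) - (p%:~R * t + phi) by ring.
  move: (n%:~R * t + psi) (p%:~R * t + phi) => x y.
  by rewrite cosD cosB; field.
under eq_bigr do rewrite E.
by rewrite big_split/= -!mulr_sumr !sum_cos_roots_of_unity// !mulr0 addr0.
Qed.

Definition trig_poly (I : finType) (w : I -> int) (a b : I -> R) (x : R) : R :=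
  \sum_i (a i * cos ((w i)%:~R * x) + b i * sin ((w i)%:~R * x)).

Lemma is_derive_trig_poly (I : finType) (w : I -> int) (a b : I -> R) (x : R) :
  is_derive x 1 (trig_poly w a b)
    (trig_poly w (fun i => (w i)%:~R * b i) (fun i => - ((w i)%:~R * a i)) x).
Proof.
have -> : trig_poly w a b = \sum_i
    (a i \*: (cos \o ( *%R (w i)%:~R)) + b i \*: (sin \o ( *%R (w i)%:~R))).
  by apply/funext => y; rewrite fct_sumE.
rewrite /trig_poly; elim/big_ind2 : _ => [|f df g dg|i _].
- exact: is_derive_cst.
- exact: is_deriveD.
by apply: is_derive_eq; rewrite /GRing.scale/=; ring.
Qed.

(** By the mean value theorem the bound on the derivative bounds the increments
    along a grid, so that [bohr_favard_grid] applies.  The grid has to be fine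
    enough for the frequencies of [trig_poly w a b] not to be aliased below
    [N]. *)
Lemma bohr_favard N (I : finType) (w : I -> int) (a b : I -> R) (D : R) :
    (0 < N)%N -> (forall i, (`|w i| < N)%N -> a i = 0 /\ b i = 0) ->
    (forall x, `|trig_poly w (fun i => (w i)%:~R * b i)
                             (fun i => - ((w i)%:~R * a i)) x| <= D) ->
  trig_poly w a b 0 <= pi * D / (2 * N%:R).
Proof.
move=> N0 gap dD; pose r := (\max_i `|w i|).+1.
have wr i : (`|w i| < r)%N by rewrite ltnS (leq_bigmax i).
set K := (N * r.*2)%N; have K0 : (0 : R) < K%:R by rewrite ltr0n /K; lia.
pose h : R := 2 * pi / K%:R.
have h0 : 0 < h by rewrite divr_gt0 ?mulr_gt0 ?pi_gt0.
have step x : `|trig_poly w a b (x + h) - trig_poly w a b x| <= D * h.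
  have dF y := is_derive_trig_poly w a b y.
  have xh : x < x + h by rewrite ltrDl.
  have cF : {within `[x, x + h], continuous (trig_poly w a b)}.
    by apply: derivable_within_continuous => y _; exact: ex_derive.
  have [c _ ->] := MVT xh (fun y _ => dF y) cF.
  by rewrite addrAC subrr add0r normrM (gtr0_norm h0) ler_wpM2r// ltW.
have := @bohr_favard_grid N r (fun m => trig_poly w a b (h * m%:R)) (D * h) N0 isT.
rewrite mulr0 => B; apply: le_trans (B _ _ _) _.
- move=> p phi pN.
  have E (x c : R) : trig_poly w a b x * c = \sum_i
     (a i * (cos ((w i)%:~R * x + 0) * c)
      + b i * (cos ((w i)%:~R * x + - (pi / 2)) * c)).
    rewrite /trig_poly mulr_suml; apply: eq_bigr => i _.
    by rewrite addr0 cosBpihalf; ring.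
  under eq_bigr do rewrite E.
  rewrite exchange_big/=; apply: big1 => i _; rewrite big_split/= -!mulr_sumr.
  have [wN|Nw] := ltnP `|w i| N.
    by have [-> ->] := gap i wN; rewrite !mul0r addr0.
  have rK : (r + N <= K)%N by rewrite /K; nia.
  have := wr i => wri.
  by rewrite !sum_cos_cos_grid ?mulr0 ?addr0//; lia.
- by move=> m; rewrite -addn1 natrD mulrDr mulr1.
- apply: eq_bigr => i _; rewrite /h divfK ?gt_eqF// mulr0.
  by rewrite [_ * (2 * pi)]mulrC -[2 * pi * _]add0r cosD_2pi_int sinD_2pi_int.
- rewrite /h /K natrM -muln2 natrM le_eqVlt; apply/orP; left; apply/eqP.
  by field; rewrite !pnatr_eq0; lia.
Qed.

End BohrFavard.

(** * The underlying real inner product space *)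

Section RealInnerProduct.
Variables (R : realType) (H : normedModType R[i]) (dot : {dot H for Num.conj}).

(** All estimates below use the real inner product [ip] and the real norm [nrm];
    the complex structure only remains through multiplication by ['i]. *)
Definition ip (x y : H) : R := complex.Re (dot x y).
Definition nrm (x : H) : R := complex.Re `|x|.

Lemma Re_real (z : R[i]) (r : R) : complex.Re (r%:C * z) = r * complex.Re z.
Proof. by case: z => a b /=; rewrite mul0r subr0. Qed.

Lemma Re_conj (z : R[i]) : complex.Re (Num.conj z) = complex.Re z.
Proof. by case: z. Qed.

Lemma ipC x y : ip x y = ip y x.
Proof. by rewrite /ip hermC /= expr0 mul1r Re_conj. Qed.

Lemma ipDl x y z : ip (x + y) z = ip x z + ip y z.
Proof. by rewrite /ip linearDl raddfD. Qed.
Lemma ipDr x y z : ip z (x + y) = ip z x + ip z y.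
Proof. by rewrite ipC ipDl !(ipC z). Qed.
Lemma ipZl (r : R) x y : ip (r%:C *: x) y = r * ip x y.
Proof. by rewrite /ip linearZl_LR /= Re_real. Qed.
Lemma ipZr (r : R) x y : ip x (r%:C *: y) = r * ip x y.
Proof. by rewrite ipC ipZl ipC. Qed.
Lemma ipNl x y : ip (- x) y = - ip x y.
Proof. by rewrite /ip linearNl raddfN. Qed.
Lemma ipNr x y : ip x (- y) = - ip x y.
Proof. by rewrite ipC ipNl ipC. Qed.
Lemma ip0l x : ip 0 x = 0.
Proof. by rewrite /ip linear0l. Qed.
Lemma ip0r x : ip x 0 = 0.
Proof. by rewrite ipC ip0l. Qed.
Lemma ipBl x y z : ip (x - y) z = ip x z - ip y z.
Proof. by rewrite ipDl ipNl. Qed.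
Lemma ipBr x y z : ip z (x - y) = ip z x - ip z y.
Proof. by rewrite ipDr ipNr. Qed.
Lemma ip_suml (I : Type) (s : seq I) (P : pred I) (F : I -> H) y :
  ip (\sum_(i <- s | P i) F i) y = \sum_(i <- s | P i) ip (F i) y.
Proof. by elim/big_rec2: _ => [|i u v _ <-]; rewrite ?ip0l ?ipDl. Qed.
Lemma ip_sumr (I : Type) (s : seq I) (P : pred I) (F : I -> H) y :
  ip y (\sum_(i <- s | P i) F i) = \sum_(i <- s | P i) ip y (F i).
Proof. by rewrite ipC ip_suml; apply: eq_bigr => i _; rewrite ipC. Qed.

Lemma ip_iil x y : ip ('i *: x) y = - ip x ('i *: y).
Proof.
rewrite /ip linearZl_LR linearZr_LR /=.
by case: (dot x y) => a b /=; ring.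
Qed.

Lemma ip_i2 x y : ip ('i *: x) ('i *: y) = ip x y.
Proof.
by rewrite ip_iil scalerA -expr2 sqr_i scaleN1r ipNr opprK.
Qed.

Lemma ipxx_ge0 x : 0 <= ip x x.
Proof. by have := dnorm_ge0 dot x; rewrite lecE => /andP[]. Qed.

Lemma ipxx_eq0 x : ip x x = 0 -> x = 0.
Proof.
move=> xx0; apply/eqP; rewrite -(dnorm_eq0 dot); apply/eqP.
have := dnorm_ge0 dot x; rewrite lecE => /andP[/eqP im0 _].
by move: im0 xx0; rewrite /ip; case: (dot x x) => a b /= -> ->.
Qed.

Lemma nrm_ge0 x : 0 <= nrm x.
Proof. by have := normr_ge0 x; rewrite lecE => /andP[]. Qed.

Lemma nrmE x : `|x| = (nrm x)%:C.
Proof.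
have := normr_ge0 x; rewrite lecE /nrm => /andP[/eqP im0 _].
by move: im0; case: (`|x|) => a b /= ->.
Qed.

Lemma CauchySchwarz_ip x y : ip x y ^+ 2 <= ip x x * ip y y.
Proof.
have [->|/eqP y0] := eqVneq y 0; first by rewrite !ip0r expr0n mulr0.
have yy : 0 < ip y y.
  by rewrite lt_neqAle ipxx_ge0 andbT eq_sym; apply/eqP => /ipxx_eq0.
have := ipxx_ge0 ((ip y y)%:C *: x - (ip x y)%:C *: y).
rewrite ipBl !ipBr !ipZl !ipZr (ipC y x) => h.
have : 0 <= ip y y * (ip x x * ip y y - ip x y ^+ 2) by nra.
by rewrite pmulr_rge0// subr_ge0.
Qed.

Hypothesis dot_norm : norm_from_dot dot.

Lemma nrm_sqr x : nrm x ^+ 2 = ip x x.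
Proof.
by rewrite /ip -dot_norm nrmE [in RHS]expr2 Re_real expr2.
Qed.

Lemma ip_le x y : ip x y <= nrm x * nrm y.
Proof.
apply: le_trans (ler_norm _) _.
rewrite -(ler_pXn2r (n := 2)) ?nnegrE ?mulr_ge0 ?nrm_ge0//.
by rewrite real_normK ?num_real// exprMn !nrm_sqr CauchySchwarz_ip.
Qed.

Lemma norm_ip_le x y : `|ip x y| <= nrm x * nrm y.
Proof.
rewrite ler_norml ip_le andbT lerNl -ipNl.
by apply: le_trans (ip_le _ _) _; rewrite /nrm normrN.
Qed.

Lemma nrmZ (r : R) x : nrm (r%:C *: x) = `|r| * nrm x.
Proof.
by rewrite /nrm normrZ normc_def /= expr0n addr0 sqrtr_sqr Re_real.
Qed.

Lemma nrmN x : nrm (- x) = nrm x. Proof. by rewrite /nrm normrN. Qed.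

Lemma nrmD x y : nrm (x + y) <= nrm x + nrm y.
Proof.
by have := ler_normD x y; rewrite !nrmE -raddfD /= lecR.
Qed.

Lemma nrm_eq0 x : nrm x = 0 -> x = 0.
Proof. by move=> x0; apply: ipxx_eq0; rewrite -nrm_sqr x0 expr0n. Qed.

End RealInnerProduct.

Section OperatorNorm.
Variables (R : realType) (H : normedModType R[i]).

Lemma continuous_linear_nrm (T : {linear H -> H}) : continuous T ->
  exists2 C, 0 <= C & forall x, nrm (T x) <= C * nrm x.
Proof.
move=> cT.
have /linear_boundedP/pinfty_ex_gt0[r r0 Tr] := (linear_bounded_continuous T).2 cT.
move: r0 Tr; rewrite ltcE => /andP[/eqP/= ri r0] Tr.
exists (complex.Re r) => [|x]; first exact: ltW.
have := Tr x; rewrite !nrmE.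
have -> : r = (complex.Re r)%:C by case: r ri {r0 Tr} => a b /= ->.
by rewrite -rmorphM lecR.
Qed.

Lemma nrm_linear_continuous (T : {linear H -> H}) C :
  (forall x, nrm (T x) <= C * nrm x) -> continuous T.
Proof.
move=> TC; apply/linear_bounded_continuous/linear_boundedP.
near=> r => x; rewrite !nrmE.
have : (`|C|)%:C <= r by near: r; apply: nbhs_pinfty_ge; rewrite ger0_real// ler0c.
have : nrm (T x) <= `|C| * nrm x.
  by apply: le_trans (TC x) _; rewrite ler_wpM2r ?nrm_ge0 ?ler_norm.
rewrite -lecR rmorphM => /le_trans + Cr; apply.
by rewrite ler_wpM2r// ler0c nrm_ge0.
Unshelve. all: by end_near. Qed.

Lemma nrm_opnorm_ball (T : {linear H -> H}) y : continuous T -> nrm y <= 1 ->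
  nrm (T y) <= opnorm T.
Proof.
move=> cT y1; have [C C0 TC] := continuous_linear_nrm cT.
apply: ub_le_sup; last by exists y => //=; rewrite nrmE lecR.
exists C => _ [z /= z1 <-]; apply: le_trans (TC z) _.
by move: z1; rewrite nrmE lecR; have := nrm_ge0 z; nra.
Qed.

Lemma opnorm_ge0 (T : {linear H -> H}) : continuous T -> 0 <= opnorm T.
Proof.
move=> cT; apply: le_trans (nrm_ge0 (T 0)) (nrm_opnorm_ball cT _).
by rewrite /nrm normr0.
Qed.

Lemma nrm_opnorm (T : {linear H -> H}) x : continuous T ->
  nrm (T x) <= opnorm T * nrm x.
Proof.
move=> cT; have [C C0 TC] := continuous_linear_nrm cT.
have [x0|x0] := eqVneq (nrm x) 0.
  by rewrite x0 mulr0; apply: le_trans (TC x) _; rewrite x0 mulr0.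
have x_gt0 : 0 < nrm x by rewrite lt_def x0 nrm_ge0.
have := @nrm_opnorm_ball T ((nrm x)^-1%:C *: x) cT.
rewrite linearZ /= !nrmZ ger0_norm ?invr_ge0 ?nrm_ge0// mulVf// => /(_ (lexx _)).
by rewrite ler_pdivrMl// mulrC.
Qed.

Lemma opnorm_le (T : H -> H) k :
  (forall x, nrm (T x) <= k * nrm x) -> 0 <= k -> opnorm T <= k.
Proof.
move=> Tk k0; apply: ge_sup => [|_ [z /= z1 <-]].
  by exists (nrm (T 0)); exists 0 => //=; rewrite normr0.
apply: le_trans (Tk z) _.
by move: z1; rewrite nrmE lecR; have := nrm_ge0 z; nra.
Qed.

End OperatorNorm.

(** * Spectral measures *)

Section SpectralMeasure.
Variables (R : realType) (H : normedModType R[i]) (dot : {dot H for Num.conj}).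
Hypothesis dot_norm : norm_from_dot dot.
Variables (B : {linear H -> H}) (E : set R -> {linear H -> H}).
Hypothesis BE : spectral_measure dot B E.
Local Notation "<< x , y >>" := (ip dot x y).
Implicit Types (D : set R) (x y z : H).

Let EP D : measurable D -> orthogonal_projection dot (E D).
Proof. by case: BE => -[+ _ _ _] _; apply. Qed.

Lemma spectral_idem D x : measurable D -> E D (E D x) = E D x.
Proof. by move=> /EP[]. Qed.

Lemma spectral_ip D x y : measurable D -> << E D x, y >> = << x, E D y >>.
Proof. by move=> /EP[_ sa]; rewrite /ip sa. Qed.

Lemma spectralI D1 D2 x : measurable D1 -> measurable D2 ->
  E (D1 `&` D2) x = E D1 (E D2 x).
Proof. by case: BE => -[_ _ + _] _ => /[apply] /[apply]; apply. Qed.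

Lemma spectralT x : E setT x = x.
Proof. by case: BE => -[_ + _ _] _; apply. Qed.

Lemma spectral_sqr D x : measurable D -> nrm (E D x) ^+ 2 = << E D x, x >>.
Proof.
by move=> mD; rewrite (nrm_sqr dot_norm) (spectral_ip x)// spectral_idem// ipC.
Qed.

Lemma spectral_mu x : exists mu : {measure set R -> \bar R},
  [/\ forall D, measurable D -> (mu D = (nrm (E D x) ^+ 2)%:E)%E,
      mu.-integrable setT (fun t : R => t%:E) &
      << B x, x >> = Rintegral mu setT (fun t : R => t)].
Proof.
case: BE => _ /(_ x)[mu [muE mui BI]]; exists mu; split=> //.
  by move=> D mD; rewrite spectral_sqr// muE.
by rewrite /ip BI.
Qed.

Lemma spectral0 x : E set0 x = 0.
Proof.
have [mu [muE _ _]] := spectral_mu x.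
have := muE _ measurable0; rewrite measure0 => -[] /esym/eqP.
by rewrite sqrf_eq0 => /eqP /(nrm_eq0 dot_norm).
Qed.

Lemma spectral_orth D1 D2 x y : measurable D1 -> measurable D2 ->
  D1 `&` D2 = set0 -> << E D1 x, E D2 y >> = 0.
Proof.
move=> m1 m2 D0; rewrite spectral_ip// -spectralI// D0 spectral0.
by rewrite ip0r.
Qed.

(** [E (D1 `|` D2) x - E D1 x - E D2 x] has norm zero because the measure
    [D |-> |E D x|^2] is additive. *)
Lemma spectralU D1 D2 x : measurable D1 -> measurable D2 ->
  D1 `&` D2 = set0 -> E (D1 `|` D2) x = E D1 x + E D2 x.
Proof.
move=> m1 m2 D0; have mU := measurableU _ _ m1 m2.
have [mu [muE _ _]] := spectral_mu x.
have : (mu (D1 `|` D2) = mu D1 + mu D2)%E by exact: measureU.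
rewrite !muE// -EFinD => -[nU].
apply/eqP; rewrite -subr_eq0 opprD addrA; apply/eqP/(nrm_eq0 dot_norm)/eqP.
have sub D : measurable D -> D `<=` D1 `|` D2 ->
    << E D x, E (D1 `|` D2) x >> = nrm (E D x) ^+ 2.
  move=> mD DU; rewrite spectral_ip// -spectralI// (setIidl DU).
  by rewrite ipC -spectral_sqr.
have := spectral_orth x x m1 m2 D0.
have := sub _ mU (@subset_refl _ _).
have := sub _ m1 (@subsetUl _ _ _); have := sub _ m2 (@subsetUr _ _ _).
move: nU; move: (E _ x) (E D1 x) (E D2 x) => w u v nU vw uw ww uv.
rewrite -sqrf_eq0 (nrm_sqr dot_norm) !(ipBl, ipBr) (ipC _ w u) (ipC _ w v) (ipC _ v u).
rewrite vw uw ww uv -!(nrm_sqr dot_norm) nU; apply/eqP; ring.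
Qed.

Lemma spectralC D x : measurable D -> E (~` D) x = x - E D x.
Proof.
move=> mD; rewrite -{2}[x]spectralT -(setUv D) spectralU ?setICr//.
  by rewrite addrC addKr.
exact: measurableC.
Qed.

Lemma spectral_sub0 D1 D2 x : measurable D1 -> measurable D2 -> D1 `<=` D2 ->
  E D2 x = 0 -> E D1 x = 0.
Proof. by move=> m1 m2 s D0; rewrite -(setIidl s) spectralI// D0 raddf0. Qed.

Lemma spectral_bigcup0 (F : (set R)^nat) x : (forall i, measurable (F i)) ->
  (forall i, E (F i) x = 0) -> E (\bigcup_i F i) x = 0.
Proof.
move=> mF F0; have [mu [muE _ _]] := spectral_mu x.
have mU : measurable (\bigcup_i F i) by exact: bigcupT_measurable.
suff : mu (\bigcup_i F i) = 0%E.
  by rewrite muE// => -[] /eqP; rewrite sqrf_eq0 => /eqP /(nrm_eq0 dot_norm).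
apply/measure_negligible/negligible_bigcup => // k; apply/negligibleP => //.
by apply: (etrans (muE _ (mF k))); rewrite F0 /nrm normr0 expr0n.
Qed.

(** Cover [D] by the countably many rational intervals that are null. *)
Lemma spectral_locally0 D x : measurable D ->
  (forall t, D t -> exists2 e : R, 0 < e & E `]t - e, t + e[%classic x = 0) ->
  E D x = 0.
Proof.
move=> mD loc.
pose F (p : rat * rat) : set R :=
  if `[< E `](ratr p.1), (ratr p.2)[%classic x = 0 >]
  then `](ratr p.1), (ratr p.2)[%classic else set0.
have mF p : measurable (F p) by rewrite /F; case: ifP => // _; exact: measurable_itv.
have F0 p : E (F p) x = 0.
  by rewrite /F; case: ifPn => [/asboolP//|_]; exact: spectral0.
pose G n := if unpickle n is Some p then F p else set0.
have mG n : measurable (G n) by rewrite /G; case: unpickle.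
have G0 n : E (G n) x = 0 by rewrite /G; case: unpickle => //; exact: spectral0.
apply: (spectral_sub0 mD _ _ (spectral_bigcup0 mG G0)).
  exact: bigcupT_measurable.
move=> t Dt; have [e e0 Et] := loc _ Dt.
have /rat_in_itvoo[p /itvP pI] : t - e < t by rewrite ltrBlDr ltrDl.
have /rat_in_itvoo[q /itvP qI] : t < t + e by rewrite ltrDl.
suff : F (p, q) t.
  by exists (pickle (p, q)); [exact: I | rewrite /G pickleK].
rewrite /F ifT; first by rewrite /= in_itv/= pI qI.
apply/asboolP.
apply: spectral_sub0 Et; [exact: measurable_itv..|].
move=> s /=; rewrite !in_itv/= => /andP[s1 s2].
by rewrite (lt_trans _ s1) ?pI// (lt_trans s2) ?qI.
Qed.

End SpectralMeasure.

Section SpectralBounds.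
Variables (R : realType) (H : normedModType R[i]) (dot : {dot H for Num.conj}).
Hypothesis dot_norm : norm_from_dot dot.
Variables (B : {linear H -> H}) (E : set R -> {linear H -> H}).
Hypothesis B_sym : forall x y, dot (B x) y = dot x (B y).
Hypothesis BE : spectral_measure dot B E.
Local Notation "<< x , y >>" := (ip dot x y).
Implicit Types (D : set R) (x y z : H).

Let Bsym x y : << B x, y >> = << x, B y >>.
Proof. by rewrite /ip B_sym. Qed.

(** The scalar spectral measure of [E D x] is that of [x] restricted to [D]. *)
Lemma quadratic_form_restrict D x (mu : {measure set R -> \bar R}) :
    measurable D ->
    (forall A, measurable A -> (mu A = (nrm (E A x) ^+ 2)%:E)%E) ->
  << B (E D x), E D x >> = Rintegral mu D (fun t : R => t).
Proof.
move=> mD muE; have [nu [nuE nui ->]] := spectral_mu dot_norm BE (E D x).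
have mDC := measurableC mD.
have restr A : measurable A -> A `<=` D -> E A (E D x) = E A x.
  by move=> mA AD; rewrite -(spectralI BE)// (setIidl AD).
have nuC : nu (~` D) = 0%E.
  apply: (etrans (nuE _ mDC)).
  by rewrite -(spectralI BE)// setICl (spectral0 dot_norm BE) /nrm normr0 expr0n.
rewrite -(setUv D) Rintegral_setU//; last 2 first.
- by rewrite setUv.
- by apply/disj_setPS; rewrite setICr.
rewrite [X in _ + X](_ : _ = 0) ?addr0; last first.
  by rewrite /Rintegral null_set_integral//.
congr fine; apply: eq_measure_integral => A mA AD.
by apply: (etrans (nuE _ mA)); rewrite restr//; exact: esym (muE _ mA).
Qed.

Lemma quadratic_form_split D x : measurable D ->
  << B x, x >> = << B (E D x), E D x >> + << B (E (~` D) x), E (~` D) x >>.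
Proof.
move=> mD; have [mu [muE mui ->]] := spectral_mu dot_norm BE x.
have mDC := measurableC mD.
rewrite (quadratic_form_restrict mD muE) (quadratic_form_restrict mDC muE).
rewrite -(setUv D) Rintegral_setU//; first by rewrite setUv.
by apply/disj_setPS; rewrite setICr.
Qed.

Lemma integrable_cst (mu : {measure set R -> \bar R}) D (b : R) :
  measurable D -> (mu D < +oo)%E -> mu.-integrable D (EFin \o cst b).
Proof.
move=> mD muD; apply/integrableP; split; first exact/measurable_EFinP.
by rewrite /= integral_cst// lte_mul_pinfty.
Qed.

Lemma quadratic_form_le D b x : measurable D -> (forall t, D t -> t <= b) ->
  << B (E D x), E D x >> <= b * nrm (E D x) ^+ 2.
Proof.
move=> mD Db; have [mu [muE mui _]] := spectral_mu dot_norm BE x.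
rewrite (quadratic_form_restrict mD muE).
have muD : (mu D = (nrm (E D x) ^+ 2)%:E)%E by exact: muE.
have -> : b * nrm (E D x) ^+ 2 = Rintegral mu D (cst b).
  by rewrite Rintegral_cst// muD.
apply: le_Rintegral => //; first exact: integrableS mui.
by apply: integrable_cst => //; rewrite muD ltry.
Qed.

Lemma quadratic_form_ge D a x : measurable D -> (forall t, D t -> a <= t) ->
  a * nrm (E D x) ^+ 2 <= << B (E D x), E D x >>.
Proof.
move=> mD Da; have [mu [muE mui _]] := spectral_mu dot_norm BE x.
rewrite (quadratic_form_restrict mD muE).
have muD : (mu D = (nrm (E D x) ^+ 2)%:E)%E by exact: muE.
have -> : a * nrm (E D x) ^+ 2 = Rintegral mu D (cst a).
  by rewrite Rintegral_cst// muD.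
apply: le_Rintegral => //; last exact: integrableS mui.
by apply: integrable_cst => //; rewrite muD ltry.
Qed.

(** Polarization of [quadratic_form_split]. *)
Lemma spectral_off_diagonal D x y : measurable D ->
  << B (E D x), E (~` D) y >> = 0.
Proof.
move=> mD; have mDC := measurableC mD.
have EE A z : measurable A -> E A (E A z) = E A z := fun m => spectral_idem BE z m.
have E0 z : E D (E (~` D) z) = 0.
  by rewrite -(spectralI BE)// setICr (spectral0 dot_norm BE).
have E0' z : E (~` D) (E D z) = 0.
  by rewrite -(spectralI BE)// setICl (spectral0 dot_norm BE).
have := quadratic_form_split (E D x + E (~` D) y) mD.
rewrite !linearD/= !EE// E0 E0' addr0 add0r !(ipDl, ipDr).
rewrite (Bsym (E (~` D) y)) (ipC _ (E (~` D) y) (B (E D x))) linear0 !ip0l.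
lra.
Qed.

Lemma spectral_commute D x : measurable D -> B (E D x) = E D (B x).
Proof.
move=> mD; have mDC := measurableC mD.
have z0 A y : measurable A -> E (~` A) (B (E A y)) = 0.
  move=> mA; have mAC := measurableC mA.
  apply: (ipxx_eq0 (dot := dot)).
  by rewrite (spectral_ip BE)// (spectral_idem BE)// spectral_off_diagonal.
have BxE : B x = B (E D x) + B (E (~` D) x).
  by rewrite -linearD (spectralC dot_norm BE)// subrKC.
have := z0 (~` D) x mDC; rewrite setCK => z1.
rewrite BxE linearD /= z1 addr0.
by have := z0 D x mD; rewrite (spectralC dot_norm BE)// => /eqP; rewrite subr_eq0 => /eqP.
Qed.

(** The quadratic form of [B - c] is bounded by [r] on the range of [E D], which
    [B] leaves invariant, and for a symmetric operator the norm is the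
    numerical radius. *)
Lemma spectral_norm_le D c r x : measurable D ->
    (forall t, D t -> `|t - c| <= r) ->
  nrm (B (E D x) - c%:C *: E D x) <= r * nrm (E D x).
Proof.
move=> mD Dr.
pose T z := B z - c%:C *: z; rewrite -/(T _).
have TD z w : T (z + w) = T z + T w by rewrite /T linearD scalerDr opprD addrACA.
have TZ (a : R) z : T (a%:C *: z) = a%:C *: T z.
  by rewrite /T linearZ /= scalerBr !scalerA mulrC.
have TN z : T (- z) = - T z by rewrite /T linearN scalerN opprB opprK addrC.
have Tsym z w : << T z, w >> = << z, T w >>.
  by rewrite /T ipBl ipBr Bsym ipZl ipZr.
have TE z : T (E D z) = E D (T z).
  by rewrite /T [in RHS]linearB [in RHS]linearZ /= spectral_commute.
have nrm_le z : << T (E D z), E D z >> <= r * nrm (E D z) ^+ 2.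
  rewrite /T ipBl ipZl -(nrm_sqr dot_norm).
  have := @quadratic_form_le D (c + r) z mD.
  have Db t : D t -> t <= c + r by move=> /Dr /ler_normlP[_]; lra.
  by move=> /(_ Db); lra.
have nrm_ge z : - (r * nrm (E D z) ^+ 2) <= << T (E D z), E D z >>.
  rewrite /T ipBl ipZl -(nrm_sqr dot_norm).
  have := @quadratic_form_ge D (c - r) z mD.
  have Db t : D t -> c - r <= t by move=> /Dr /ler_normlP[+ _]; lra.
  by move=> /(_ Db); lra.
set u := E D x; set y := T u.
have yE : y = E D y by rewrite /y /u TE (spectral_idem BE).
have [y0|y0] := eqVneq (nrm y) 0.
  rewrite y0 /u; have [-> |u0] := eqVneq (nrm (E D x)) 0; first by rewrite mulr0.
  have := le_trans (nrm_ge x) (nrm_le x); have := nrm_ge0 (E D x).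
  rewrite le_eqVlt eq_sym (negPf u0)/= => un.
  by rewrite -subr_ge0 opprK; nra.
have y_gt0 : 0 < nrm y by rewrite lt_def y0 nrm_ge0.
have [u0|u0] := eqVneq (nrm u) 0.
  move: y0; rewrite /y (nrm_eq0 dot_norm u0) /T linear0 scaler0 subrr.
  by rewrite /nrm normr0 eqxx.
have u_gt0 : 0 < nrm u by rewrite lt_def u0 nrm_ge0.
clearbody T.
(* polarization along the directions of u and y, rescaled to equal length *)
pose a := (nrm y)%:C *: u; pose b := (nrm u)%:C *: y.
have aE : a + b = E D ((nrm y)%:C *: x + (nrm u)%:C *: y).
  by rewrite linearD !linearZ /= -yE.
have bE : a - b = E D ((nrm y)%:C *: x - (nrm u)%:C *: y).
  by rewrite linearB !linearZ /= -yE.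
have := nrm_le ((nrm y)%:C *: x + (nrm u)%:C *: y); rewrite -aE => h1.
have := nrm_ge ((nrm y)%:C *: x - (nrm u)%:C *: y); rewrite -bE => h2.
move: h1 h2; rewrite !(nrm_sqr dot_norm) !TD TN !(ipDl, ipDr, ipNl, ipNr).
rewrite (Tsym b a) (ipC _ b a) (ipC _ b (T a)).
have -> : << T a, b >> = nrm y ^+ 3 * nrm u.
  by rewrite /a /b TZ ipZl ipZr -/y -(nrm_sqr dot_norm); ring.
have -> : << a, a >> = nrm y ^+ 2 * nrm u ^+ 2.
  by rewrite /a ipZl ipZr -(nrm_sqr dot_norm); ring.
have -> : << b, b >> = nrm y ^+ 2 * nrm u ^+ 2.
  by rewrite /b ipZl ipZr -(nrm_sqr dot_norm); ring.
move=> h1 h2.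
have : (nrm y ^+ 2 * nrm u) * nrm y <= (nrm y ^+ 2 * nrm u) * (r * nrm u) by lra.
by rewrite ler_pM2l// mulr_gt0// exprn_gt0.
Qed.

(** [B - c] is definite on either half of the range of [E D] when [D] is cut at
    [c]; pair [(B - c) x] with the vector obtained from [x] by changing the sign
    of its component in the lower half. *)
Lemma spectral_norm_ge D c r x : measurable D ->
    (forall t, D t -> r <= `|t - c|) ->
  r * nrm (E D x) <= nrm (B (E D x) - c%:C *: E D x).
Proof.
move=> mD Dr.
have mU : measurable `[c, +oo[%classic by exact: measurable_itv.
pose D1 := D `&` `[c, +oo[; pose D2 := D `&` ~` `[c, +oo[.
have m1 : measurable D1 by exact: measurableI.
have m2 : measurable D2 by apply: measurableI => //; exact: measurableC.
have D120 : D1 `&` D2 = set0 by rewrite /D1 /D2 setIACA setICr setI0.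
have DE : D1 `|` D2 = D by rewrite /D1 /D2 -setIUr setUv setIT.
have xE : E D x = E D1 x + E D2 x by rewrite -DE (spectralU dot_norm BE).
have h1 : (c + r) * nrm (E D1 x) ^+ 2 <= << B (E D1 x), E D1 x >>.
  apply: quadratic_form_ge => // t [/Dr + /=]; rewrite in_itv/= andbT => + ct.
  by rewrite ger0_norm ?subr_ge0//; lra.
have h2 : << B (E D2 x), E D2 x >> <= (c - r) * nrm (E D2 x) ^+ 2.
  apply: quadratic_form_le => // t [/Dr + /=]; rewrite in_itv/= andbT => + /negP.
  by rewrite -ltNge => + ct; rewrite ltr0_norm ?subr_lt0//; lra.
have o12 y z : << E D1 y, E D2 z >> = 0 := spectral_orth dot_norm BE y z m1 m2 D120.
have o1 : << B (E D1 x), E D2 x >> = 0 by rewrite spectral_commute// o12.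
have o2 : << B (E D2 x), E D1 x >> = 0.
  by rewrite spectral_commute// (ipC _ _ (E D1 x)) o12.
have := ip_le dot_norm (B (E D x) - c%:C *: E D x) (E D1 x - E D2 x).
have -> : nrm (E D1 x - E D2 x) = nrm (E D x).
  apply/eqP; rewrite -(eqrXn2 (n := 2)) ?nrm_ge0// !(nrm_sqr dot_norm) xE.
  by rewrite !(ipDl, ipDr, ipNl, ipNr) (ipC _ (E D2 x) (E D1 x)) o12; apply/eqP; ring.
have [->|x0] := eqVneq (nrm (E D x)) 0; first by rewrite !mulr0 nrm_ge0.
have x_gt0 : 0 < nrm (E D x) by rewrite lt_def x0 nrm_ge0.
have : r * nrm (E D x) ^+ 2 <= << B (E D x) - c%:C *: E D x, E D1 x - E D2 x >>.
  rewrite (nrm_sqr dot_norm) xE linearD scalerDr.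
  rewrite !(ipDl, ipDr, ipNl, ipNr, ipZl) (ipC _ (E D2 x) (E D1 x)) o12 o1 o2.
  by rewrite -!(nrm_sqr dot_norm); lra.
move=> /le_trans /[apply]; rewrite expr2 mulrA ler_pM2r//.
Qed.

End SpectralBounds.

Section Projections.
Variables (R : realType) (H : normedModType R[i]) (dot : {dot H for Num.conj}).
Hypothesis dot_norm : norm_from_dot dot.
Variables (B : {linear H -> H}) (E : set R -> {linear H -> H}).
Hypothesis BE : spectral_measure dot B E.
Local Notation "<< x , y >>" := (ip dot x y).
Implicit Types (D : set R) (x y z : H).

Lemma spectral_contract D x : measurable D -> nrm (E D x) <= nrm x.
Proof.
move=> mD; have := ip_le dot_norm (E D x) x.
rewrite -(spectral_sqr dot_norm BE)//.
have := nrm_ge0 (E D x); rewrite le_eqVlt => /predU1P[<- _|E0].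
  exact: nrm_ge0.
by rewrite expr2 ler_pM2l.
Qed.

Lemma spectral_sum n (D : nat -> set R) x : (forall j, measurable (D j)) ->
    (forall i j, i != j -> D i `&` D j = set0) ->
  E (\big[setU/set0]_(j < n) D j) x = \sum_(j < n) E (D j) x.
Proof.
move=> mD disj; elim: n => [|n IH].
  by rewrite !big_ord0 (spectral0 dot_norm BE).
rewrite !big_ord_recr/= (spectralU dot_norm BE) ?IH//.
  exact: bigsetU_measurable.
rewrite big_distrl/= big1// => i _.
by rewrite disj// neq_ltn ltn_ord.
Qed.

Lemma nrm_sum_orthogonal (I : finType) (z : I -> H) :
    (forall i j, i != j -> << z i, z j >> = 0) ->
  nrm (\sum_i z i) ^+ 2 = \sum_i nrm (z i) ^+ 2.
Proof.
move=> orth; rewrite (nrm_sqr dot_norm) ip_suml; apply: eq_bigr => i _.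
rewrite ip_sumr (bigD1 i)//= big1 ?addr0 ?(nrm_sqr dot_norm)// => j ji.
by rewrite orth// eq_sym.
Qed.

End Projections.

(** * The theorem of Davis and Kahan *)

Section SinTheta.
Variables (R : realType) (H : normedModType R[i]) (dot : {dot H for Num.conj}).
Hypothesis dot_norm : norm_from_dot dot.
Variables (A B : {linear H -> H}) (E F : set R -> {linear H -> H}) (v : R).
Hypothesis A_sym : forall x y, dot (A x) y = dot x (A y).
Hypothesis B_sym : forall x y, dot (B x) y = dot x (B y).
Hypothesis AE : spectral_measure dot A E.
Hypothesis BF : spectral_measure dot B F.
Hypothesis v_ge0 : 0 <= v.
Hypothesis ABv : forall x, nrm (B x - A x) <= v * nrm x.
Local Notation "<< x , y >>" := (ip dot x y).
Implicit Types (S T : set R) (x y z : H).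

(** Let [k] be the norm of [F T (E S)] and [u] be in the range of [E S].  Then
    [(r + delta) |F T u| <= |(B - c) (F T u)| = |F T ((A - c) u + (B - A) u)|],
    which is at most [k r |u| + v |u|].  Hence [(r + delta) k <= r k + v]. *)
Lemma davis_kahan S T c r delta x : measurable S -> measurable T ->
    0 <= r -> 0 < delta ->
    (forall t, S t -> `|t - c| <= r) -> (forall t, T t -> r + delta <= `|t - c|) ->
  nrm (F T (E S x)) <= v / delta * nrm x.
Proof.
move=> mS mT r0 d0 Sr Tr; pose W : {linear H -> H} := F T \o E S.
have W1 y : nrm (W y) <= 1 * nrm y.
  rewrite mul1r; apply: le_trans (spectral_contract dot_norm BF _ mT) _.
  exact: (spectral_contract dot_norm AE).
have cW : continuous W := nrm_linear_continuous W1.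
pose k := opnorm W.
have Wk y : nrm (W y) <= k * nrm y := nrm_opnorm y cW.
have k0 : 0 <= k := opnorm_ge0 cW.
have rd0 : 0 < r + delta by lra.
suff kle : k <= (r * k + v) / (r + delta).
  apply: le_trans (Wk x) _; apply: ler_wpM2r; first exact: nrm_ge0.
  by rewrite ler_pdivlMr//; move: kle; rewrite ler_pdivlMr//; lra.
apply: opnorm_le; last by rewrite divr_ge0 ?addr_ge0 ?mulr_ge0// ltW.
move=> y; rewrite mulrAC ler_pdivlMr// mulrC; set u := E S y.
have uy : nrm u <= nrm y by exact: (spectral_contract dot_norm AE).
apply: le_trans (spectral_norm_ge dot_norm B_sym BF u mT Tr) _.
have -> : B (F T u) - c%:C *: F T u =
    W (A u - c%:C *: u) + F T (B u - A u).
  rewrite /W /= [E S _]linearB [E S (_ *: _)]linearZ /=.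
  rewrite -(spectral_commute dot_norm A_sym AE)// (spectral_idem AE)//.
  rewrite (spectral_commute dot_norm B_sym BF)// -linearZ -linearD -linearB /=.
  by congr (F T _); rewrite [RHS]addrC subrKA.
apply: le_trans (nrmD _ _) _; rewrite addrC mulrDl [leRHS]addrC; apply: lerD.
  apply: le_trans (spectral_contract dot_norm BF _ mT) _.
  by apply: le_trans (ABv _) _; exact: ler_wpM2l.
apply: le_trans (Wk _) _; rewrite [r * k]mulrC -mulrA; apply: ler_wpM2l => //.
apply: le_trans (spectral_norm_le dot_norm A_sym AE _ mS Sr) _.
exact: ler_wpM2l.
Qed.

End SinTheta.

(** * The theorem of Bhatia, Davis and McIntosh *)

Section Cells.
Variable R : realType.
Implicit Types (a h : R) (S : set R).

Definition cell a h (j : nat) : set R :=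
  `[a + j%:R * h, a + j.+1%:R * h[%classic.

Lemma cellP a h j t : cell a h j t <-> a + j%:R * h <= t < a + j.+1%:R * h.
Proof. by rewrite /cell /= in_itv. Qed.

Lemma measurable_cell a h j : measurable (cell a h j).
Proof. exact: measurable_itv. Qed.

Lemma cell_dist a h i j s t : 0 < h -> cell a h i s -> cell a h j t ->
  `|s - t| < (`|(i%:Z - j%:Z)%R|.+1)%:R * h.
Proof.
move=> h0 /cellP/andP[s1 s2] /cellP/andP[t1 t2].
rewrite -addn1 natrD in s2; rewrite -addn1 natrD in t2.
rewrite -addn1 natrD mulrDl mul1r ltr_norml.
have -> : (`|(i%:Z - j%:Z)%R|%N)%:R = `|i%:R - j%:R| :> R.
  by rewrite [LHS]pmulrn abszE intr_norm rmorphB.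
have h1 : (i%:R - j%:R) * h <= `|i%:R - j%:R| * h.
  by rewrite ler_pM2r// ler_norm.
have h2 : - (`|i%:R - j%:R| * h) <= (i%:R - j%:R) * h.
  by rewrite -mulNr ler_pM2r// lerNl -normrN ler_norm.
by apply/andP; split; lra.
Qed.

Lemma cell_disjoint a h i j : 0 < h -> i != j -> cell a h i `&` cell a h j = set0.
Proof.
move=> h0; rewrite -subset0.
wlog ij : i j / (i < j)%N.
  by move=> W; rewrite neq_ltn => /orP[]ij; [|rewrite setIC]; apply: W;
    rewrite // neq_ltn ij ?orbT.
move=> _ t [/cellP/andP[_ t1] /cellP/andP[t2 _]].
have : (i.+1%:R : R) * h <= j%:R * h by rewrite ler_pM2r// ler_nat.
lra.
Qed.

Lemma cells_cover a h n S : 0 < h -> S `<=` `[a, a + n%:R * h[%classic ->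
  \big[setU/set0]_(j < n) (S `&` cell a h j) = S.
Proof.
move=> h0 Sn; rewrite -[RHS](setIidl Sn) {Sn}.
elim: n => [|n IH]; first by rewrite big_ord0 mul0r addr0 set_itvco0 setI0.
rewrite big_ord_recr/= IH -setIUr; congr (S `&` _).
rewrite /cell; apply/seteqP; split=> t /=; rewrite !in_itv/=.
  have n0 : (n%:R : R) * h <= n.+1%:R * h by rewrite ler_pM2r// ler_nat.
  have n1 : (0 : R) <= n%:R * h by rewrite mulr_ge0// ltW.
  by move=> [|] /andP[t1 t2]; apply/andP; split; lra.
move=> /andP[t1 t2]; have [tn|tn] := ltP t (a + n%:R * h).
  by left; rewrite t1.
by right; rewrite t2.
Qed.

End Cells.

Section Phases.
Variables (R : realType) (H : normedModType R[i]) (dot : {dot H for Num.conj}).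
Hypothesis dot_norm : norm_from_dot dot.
Local Notation "<< x , y >>" := (ip dot x y).

(** Multiplication by the phase [exp (- i a)], in real terms. *)
Definition phase (a : R) (z : H) : H :=
  (cos a)%:C *: z - (sin a)%:C *: ('i *: z).

Lemma ip_phase a b q p : << phase a q, phase b p >> =
  cos (a - b) * << q, p >> + sin (a - b) * << q, 'i *: p >>.
Proof.
rewrite /phase !(ipBl, ipBr, ipZl, ipZr) ip_i2 ip_iil cosB sinB; ring.
Qed.

Lemma nrm_phase a z : nrm (phase a z) = nrm z.
Proof.
apply/eqP; rewrite -(eqrXn2 (n := 2)) ?nrm_ge0// !(nrm_sqr dot_norm) ip_phase.
by rewrite subrr cos0 sin0 mul1r mul0r addr0.
Qed.

Lemma linear_phase (T : {linear H -> H}) a z : T (phase a z) = phase a (T z).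
Proof. by rewrite /phase linearB !linearZ. Qed.

Lemma phase_i a z : 'i *: phase a z = phase a ('i *: z).
Proof. by rewrite /phase scalerBr !scalerA; congr (_ *: _ - _ *: _); ring.
Qed.

Lemma nrm_i (z : H) : nrm ('i *: z) = nrm z.
Proof.
by apply/eqP; rewrite -(eqrXn2 (n := 2)) ?nrm_ge0// !(nrm_sqr dot_norm) ip_i2.
Qed.

End Phases.

Section Discretization.
Variables (R : realType) (H : normedModType R[i]) (dot : {dot H for Num.conj}).
Hypothesis dot_norm : norm_from_dot dot.
Variables (B : {linear H -> H}) (E : set R -> {linear H -> H}).
Hypothesis B_sym : forall x y, dot (B x) y = dot x (B y).
Hypothesis BE : spectral_measure dot B E.
Variables (a h : R) (h_gt0 : 0 < h) (S : set R) (mS : measurable S) (n : nat).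
Local Notation "<< x , y >>" := (ip dot x y).
Local Notation D j := (S `&` cell a h j).

Let mD j : measurable (D j).
Proof. by apply: measurableI => //; exact: measurable_cell. Qed.

Let D_disjoint i j : i != j -> D i `&` D j = set0.
Proof. by move=> ij; rewrite setIACA cell_disjoint// setI0. Qed.

(** On the range of [E (D j)] the operator [B] differs from the left end of the
    cell [j] by at most [h], and the errors of distinct cells are orthogonal. *)
Lemma discretize (z : 'I_n -> H) : (forall j : 'I_n, E (D j) (z j) = z j) ->
  nrm (\sum_(j < n) (a + j%:R * h)%:C *: z j - B (\sum_j z j)) <= h * nrm (\sum_j z j).
Proof.
move=> zE.
have orth (i j : 'I_n) (x y : H) : i != j -> << E (D i) x, E (D j) y >> = 0.
  by move=> ij; apply: (spectral_orth dot_norm BE) => //; exact: D_disjoint.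
pose r (j : 'I_n) := (a + j%:R * h)%:C *: z j - B (z j).
have rE (j : 'I_n) : r j = E (D j) (r j).
  by rewrite /r linearB linearZ /= -(spectral_commute dot_norm B_sym BE)// zE.
have -> : \sum_(j < n) (a + j%:R * h)%:C *: z j - B (\sum_j z j) = \sum_j r j.
  by rewrite linear_sum -sumrB.
rewrite -(ler_pXn2r (n := 2)) ?nnegrE ?mulr_ge0 ?nrm_ge0 ?(ltW h_gt0)//.
rewrite exprMn !(nrm_sum_orthogonal dot_norm); last 2 first.
- by move=> i j ij; rewrite -(zE i) -(zE j) orth.
- by move=> i j ij; rewrite (rE i) (rE j) orth.
rewrite mulr_sumr; apply: ler_sum => j _; rewrite -exprMn.
rewrite ler_pXn2r ?nnegrE ?mulr_ge0 ?nrm_ge0 ?(ltW h_gt0)//.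
rewrite /r -nrmN opprB -(zE j).
apply: (spectral_norm_le dot_norm B_sym BE) => // t [_ /cellP/andP[t1 t2]].
rewrite -addn1 natrD mulrDl mul1r in t2.
by rewrite ger0_norm; lra.
Qed.

(** The vector [exp (- i th B') x], where [B'] is the operator that equals [j]
    on the range of [E (D j)]: up to an affine change, the discretized [B].
    Integer eigenvalues make it a trigonometric polynomial in [th]. *)
Definition phase_orbit (x : H) (th : R) : H :=
  \sum_(j < n) phase (j%:R * th) (E (D j) x).

Lemma spectral_phase_orbit x th (j : 'I_n) :
  E (D j) (phase (j%:R * th) (E (D j) x)) = phase (j%:R * th) (E (D j) x).
Proof. by rewrite linear_phase (spectral_idem BE). Qed.

Hypothesis S_cells : S `<=` `[a, a + n%:R * h[%classic.

Lemma sum_cells x : \sum_(j < n) E (D j) x = E S x.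
Proof.
rewrite -{2}(cells_cover h_gt0 S_cells).
by rewrite (spectral_sum dot_norm BE n _ mD D_disjoint).
Qed.

Lemma phase_orbit0 x : phase_orbit x 0 = E S x.
Proof.
rewrite -sum_cells; apply: eq_bigr => j _.
by rewrite mulr0 /phase cos0 sin0 scale1r scale0r subr0.
Qed.

Lemma nrm_phase_orbit x th : nrm (phase_orbit x th) <= nrm x.
Proof.
apply: le_trans (spectral_contract dot_norm BE x mS); rewrite -sum_cells.
have orth (i j : 'I_n) (y z : H) : i != j -> << E (D i) y, E (D j) z >> = 0.
  by move=> ij; apply: (spectral_orth dot_norm BE) => //; exact: D_disjoint.
rewrite -(ler_pXn2r (n := 2)) ?nnegrE ?nrm_ge0//.
rewrite !(nrm_sum_orthogonal dot_norm).
- by apply: ler_sum => j _; rewrite (nrm_phase dot_norm).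
- by move=> i j ij; exact: orth.
- by move=> i j ij; rewrite -(spectral_phase_orbit x th i) -(spectral_phase_orbit x th j) orth.
Qed.

End Discretization.

Section Resonance.
Variables (R : realType) (H : normedModType R[i]) (dot : {dot H for Num.conj}).
Hypothesis dot_norm : norm_from_dot dot.
Variables (A B : {linear H -> H}) (E F : set R -> {linear H -> H}) (v : R).
Hypothesis A_sym : forall x y, dot (A x) y = dot x (A y).
Hypothesis B_sym : forall x y, dot (B x) y = dot x (B y).
Hypothesis AE : spectral_measure dot A E.
Hypothesis BF : spectral_measure dot B F.
Hypothesis v_ge0 : 0 <= v.
Hypothesis ABv : forall x, nrm (B x - A x) <= v * nrm x.
Local Notation "<< x , y >>" := (ip dot x y).
Implicit Types (S T : set R) (x y z : H).

(** The scalar product is the value at [0] of the trigonometric polynomial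
    [th |-> <W th, U th>].  Its frequencies are the differences [k - j] of the
    indices of cells that meet [T] and [S]; as cells are half-open of width [h],
    these differences are at least [M]. *)
Lemma ip_spectral_cells_le S T (a h : R) (n M : nat) x y :
    measurable S -> measurable T -> 0 < h -> (0 < M)%N ->
    S `<=` `[a, a + n%:R * h[%classic -> T `<=` `[a, a + n%:R * h[%classic ->
    (forall s t, S s -> T t -> M%:R * h <= `|s - t|) ->
  << F T x, E S y >> <= pi / 2 * ((v + 2 * h) / (M%:R * h)) * (nrm x * nrm y).
Proof.
move=> mS mT h0 M0 Sn Tn gap.
pose q (k : 'I_n) := F (T `&` cell a h k) x.
pose p (j : 'I_n) := E (S `&` cell a h j) y.
pose al (kj : 'I_n * 'I_n) := << q kj.1, p kj.2 >>.
pose be (kj : 'I_n * 'I_n) := << q kj.1, 'i *: p kj.2 >>.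
pose w (kj : 'I_n * 'I_n) : int := kj.1%:Z - kj.2%:Z.
pose W th := phase_orbit F a h T n x th; pose U th := phase_orbit E a h S n y th.
have WU th : << W th, U th >> = trig_poly w al be th.
  rewrite /W /U /phase_orbit ip_suml /trig_poly -(pair_bigA _ (fun k j =>
    al (k, j) * cos ((w (k, j))%:~R * th) + be (k, j) * sin ((w (k, j))%:~R * th)))/=.
  apply: eq_bigr => k _; rewrite ip_sumr; apply: eq_bigr => j _.
  by rewrite ip_phase -mulrBl /w rmorphB/= mulrC [X in _ + X]mulrC.
have -> : << F T x, E S y >> = trig_poly w al be 0.
  by rewrite -WU /W /U (phase_orbit0 dot_norm BF)// (phase_orbit0 dot_norm AE).
apply: (le_trans (@bohr_favard R M _ w al be ((v + 2 * h) / h * (nrm x * nrm y)) M0 _ _)).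
- move=> [k j] wM; rewrite /al /be /q /p /=.
  have [->|/set0P[t [Tt kt]]] := eqVneq (T `&` cell a h k) set0.
    by rewrite (spectral0 dot_norm BF) !ip0l.
  have [->|/set0P[s [Ss js]]] := eqVneq (S `&` cell a h j) set0.
    by rewrite (spectral0 dot_norm AE) scaler0 !ip0r.
  suff : `|s - t| < M%:R * h by rewrite ltNge gap.
  rewrite distrC; apply: lt_le_trans (cell_dist h0 kt js) _.
  by rewrite ler_pM2r// ler_nat.
- move=> th; set tp := trig_poly _ _ _ _.
  pose LW := \sum_(k < n) (a + k%:R * h)%:C *: phase (k%:R * th) (q k).
  pose LU := \sum_(j < n) (a + j%:R * h)%:C *: ('i *: phase (j%:R * th) (p j)).
  have iU : 'i *: U th = \sum_(j < n) 'i *: phase (j%:R * th) (p j).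
    by rewrite /U /phase_orbit scaler_sumr.
  have tpE : h * tp = << LW, 'i *: U th >> - << W th, LU >>.
    rewrite /tp /trig_poly -(pair_bigA _ (fun k j =>
        (w (k, j))%:~R * be (k, j) * cos ((w (k, j))%:~R * th)
      + - ((w (k, j))%:~R * al (k, j)) * sin ((w (k, j))%:~R * th)))/= iU !ip_suml -sumrB mulr_sumr.
    apply: eq_bigr => k _; rewrite !ip_sumr -sumrB mulr_sumr.
    apply: eq_bigr => j _; rewrite ipZl ipZr phase_i ip_phase scalerA.
    rewrite -expr2 sqr_i scaleN1r ipNr -mulrBl.
    rewrite -[k%:R * th - _]mulrBl /w rmorphB /al /be /= -!pmulrn.
    by move: (cos _) (sin _) => ? ?; ring.
  have e1 : nrm (LW - B (W th)) <= h * nrm x.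
    apply: (@le_trans _ _ (h * nrm (W th))); last first.
      by apply: ler_wpM2l; [exact: ltW | exact: (nrm_phase_orbit dot_norm BF)].
    apply: (discretize dot_norm B_sym BF h0 mT) => k.
    exact: (spectral_phase_orbit BF).
  have e2 : nrm (LU - A ('i *: U th)) <= h * nrm y.
    apply: (@le_trans _ _ (h * nrm ('i *: U th))); last first.
      rewrite (nrm_i dot_norm).
      by apply: ler_wpM2l; [exact: ltW | exact: (nrm_phase_orbit dot_norm AE)].
    rewrite iU; apply: (discretize dot_norm A_sym AE h0 mS) => j.
    by rewrite linearZ /=; congr (_ *: _); exact: (spectral_phase_orbit AE).
  have Wx : nrm (W th) <= nrm x by exact: (nrm_phase_orbit dot_norm BF).
  have Uy : nrm ('i *: U th) <= nrm y.
    by rewrite (nrm_i dot_norm); exact: (nrm_phase_orbit dot_norm AE).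
  have Asym z z' : << A z, z' >> = << z, A z' >> by rewrite /ip A_sym.
  (* replacing the discretized operators by A and B costs the errors e1, e2 *)
  have htp : h * tp = << B (W th) - A (W th), 'i *: U th >>
      + << LW - B (W th), 'i *: U th >> - << W th, LU - A ('i *: U th) >>.
    by rewrite tpE !(ipBl, ipBr) Asym; ring.
  have b1 : `|<< B (W th) - A (W th), 'i *: U th >>| <= v * nrm x * nrm y.
    apply: le_trans (norm_ip_le dot_norm _ _) _.
    apply: ler_pM => //; try exact: nrm_ge0.
    by apply: le_trans (ABv _) _; apply: ler_wpM2l.
  have b2 : `|<< LW - B (W th), 'i *: U th >>| <= h * nrm x * nrm y.
    apply: le_trans (norm_ip_le dot_norm _ _) _.
    by apply: ler_pM => //; exact: nrm_ge0.
  have b3 : `|<< W th, LU - A ('i *: U th) >>| <= h * nrm x * nrm y.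
    apply: le_trans (norm_ip_le dot_norm _ _) _.
    rewrite [leRHS](_ : _ = nrm x * (h * nrm y)); last by ring.
    by apply: ler_pM => //; exact: nrm_ge0.
  rewrite -(ler_pM2l h0) -{1}(gtr0_norm h0) -normrM htp.
  rewrite [leRHS](_ : _ = v * nrm x * nrm y + h * nrm x * nrm y + h * nrm x * nrm y).
    by apply: le_trans (ler_normB _ _) _; apply: lerD => //;
      apply: le_trans (ler_normD _ _) _; exact: lerD.
  by field; rewrite lt0r_neq0.
- rewrite le_eqVlt; apply/orP; left; apply/eqP; field.
  by rewrite !pnatr_eq0 -lt0n M0 lt0r_neq0.
Qed.

End Resonance.

Section BoundedSpectralMeasure.
Variables (R : realType) (H : normedModType R[i]) (dot : {dot H for Num.conj}).
Hypothesis dot_norm : norm_from_dot dot.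
Variables (A : {linear H -> H}) (E : set R -> {linear H -> H}).
Hypothesis A_cont : continuous A.
Hypothesis A_sym : forall x y, dot (A x) y = dot x (A y).
Hypothesis AE : spectral_measure dot A E.
Implicit Types (S D : set R) (x y z : H).

(** If [D] lies outside [[- l, l[], then [|A u| >= (C + 1) |u|] on the range of
    [E D], where [C] is a bound of [A]. *)
Lemma spectral_bounded : exists2 L : R, 0 < L &
  forall l D x, L <= l -> measurable D -> E (D `&` `[- l, l[) x = E D x.
Proof.
have [C C0 AC] := continuous_linear_nrm A_cont.
exists (C + 1) => [|l D x Cl mD]; first by lra.
have mI : measurable `[- l, l[%classic by exact: measurable_itv.
have mIC := measurableC mI.
have null z : E (~` `[- l, l[%classic) z = 0.
  apply: (nrm_eq0 dot_norm); apply/eqP; rewrite eq_le nrm_ge0 andbT.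
  have far t : (~` `[- l, l[%classic) t -> C + 1 <= `|t - 0|.
    rewrite /= in_itv/= subr0 => /negP; rewrite negb_and -!ltNge -leNgt.
    by rewrite ler_normr => /orP[] h; apply/orP; [right|left]; lra.
  have := spectral_norm_ge dot_norm A_sym AE z mIC far.
  rewrite scale0r subr0 => /le_trans/(_ (AC _)).
  by lra.
rewrite (spectralI AE)// -[in RHS](subrK (E `[- l, l[%classic x) x).
by rewrite -(spectralC dot_norm AE)// null add0r.
Qed.

End BoundedSpectralMeasure.

Section SinThetaPi.
Variables (R : realType) (H : normedModType R[i]) (dot : {dot H for Num.conj}).
Hypothesis dot_norm : norm_from_dot dot.
Variables (A B : {linear H -> H}) (E F : set R -> {linear H -> H}) (v : R).
Hypothesis A_cont : continuous A.
Hypothesis B_cont : continuous B.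
Hypothesis A_sym : forall x y, dot (A x) y = dot x (A y).
Hypothesis B_sym : forall x y, dot (B x) y = dot x (B y).
Hypothesis AE : spectral_measure dot A E.
Hypothesis BF : spectral_measure dot B F.
Hypothesis v_ge0 : 0 <= v.
Hypothesis ABv : forall x, nrm (B x - A x) <= v * nrm x.
Implicit Types (S T : set R) (x y z : H).

(** Apply [ip_spectral_cells_le] with cells of width [delta / M], for large [M]. *)
Lemma ip_spectral_le S T delta x y : measurable S -> measurable T -> 0 < delta ->
    (forall s t, S s -> T t -> delta <= `|s - t|) ->
  ip dot (F T x) (E S y) <= pi / 2 * (v / delta) * (nrm x * nrm y).
Proof.
move=> mS mT d0 gap.
have [L1 L10 EL] := spectral_bounded dot_norm A_cont A_sym AE.
have [L2 L20 FL] := spectral_bounded dot_norm B_cont B_sym BF.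
pose L := Num.max L1 L2.
have L0 : 0 < L by rewrite lt_max L10.
rewrite -(EL L S)// ?le_max ?lexx// -(FL L T)// ?le_max ?lexx ?orbT//.
apply/ler_addgt0Pr => e e0.
have [M0 M0e] : exists M0 : nat, pi * (nrm x * nrm y) / e < M0%:R.
  by exists (Num.truncn (pi * (nrm x * nrm y) / e)).+1; exact: truncnS_gt.
pose M := M0.+1; pose h := delta / M%:R.
have M_gt0 : (0 : R) < M%:R by rewrite ltr0n.
have h0 : 0 < h by rewrite divr_gt0.
have Mh : M%:R * h = delta by rewrite /h mulrC divfK ?lt0r_neq0.
have [n nL] : exists n : nat, (L + L) / h < n%:R.
  by exists (Num.truncn ((L + L) / h)).+1; exact: truncnS_gt.
have box D : D `&` `[- L, L[%classic `<=` `[- L, - L + n%:R * h[%classic.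
  move=> t [_ /=]; rewrite !in_itv/= => /andP[-> tL] /=.
  by move: nL; rewrite ltr_pdivrMr//; lra.
have mI D : measurable D -> measurable (D `&` `[- L, L[%classic).
  by move=> mD; apply: measurableI => //; exact: measurable_itv.
have := @ip_spectral_cells_le _ _ _ dot_norm _ _ _ _ _ A_sym B_sym AE BF v_ge0 ABv
  _ _ (- L) h n M x y (mI S mS) (mI T mT) h0 isT (box S) (box T).
rewrite Mh => /(_ _)/le_trans; apply; first by move=> s t [Ss _] [Tt _]; exact: gap.
have -> : pi / 2 * ((v + 2 * h) / delta) * (nrm x * nrm y) =
  pi / 2 * (v / delta) * (nrm x * nrm y) + pi * (nrm x * nrm y) / M%:R.
  by rewrite -Mh; field; rewrite !lt0r_neq0.
rewrite lerD2l ler_pdivrMr// -ler_pdivrMl// mulrC; apply: ltW.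
by apply: lt_le_trans M0e _; rewrite ler_nat.
Qed.

Lemma bhatia_davis_mcintosh S T delta x : measurable S -> measurable T ->
    0 < delta -> (forall s t, S s -> T t -> delta <= `|s - t|) ->
  nrm (E S (F T x)) <= pi / 2 * (v / delta) * nrm x.
Proof.
move=> mS mT d0 gap; set u := E S (F T x).
have k0 : 0 <= pi / 2 * (v / delta).
  by rewrite mulr_ge0 ?divr_ge0 ?pi_ge0 ?(ltW d0).
have := nrm_ge0 u; rewrite le_eqVlt => /predU1P[<-|u0].
  by rewrite mulr_ge0 ?nrm_ge0.
have := ip_spectral_le x u mS mT d0 gap.
rewrite -(spectral_ip AE)// -/u -(nrm_sqr dot_norm) expr2 mulrA.
by rewrite ler_pM2r.
Qed.

(** [E S (F T)] and [F T (E S)] are adjoint, so they have the same norm. *)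
Lemma projections_adjoint_le S T k : measurable S -> measurable T -> 0 <= k ->
    (forall x, nrm (F T (E S x)) <= k * nrm x) ->
  forall x, nrm (E S (F T x)) <= k * nrm x.
Proof.
move=> mS mT k0 FEk x; set u := E S (F T x).
have := nrm_ge0 u; rewrite le_eqVlt => /predU1P[<-|u0].
  by rewrite mulr_ge0 ?nrm_ge0.
rewrite -(ler_pM2r u0) -expr2 (nrm_sqr dot_norm) {1}/u (spectral_ip AE)//.
rewrite (spectral_ip BF)//.
apply: le_trans (ip_le dot_norm _ _) _.
rewrite mulrC [k * _]mulrC -mulrA [leRHS]mulrC; apply: ler_wpM2r; first exact: nrm_ge0.
by apply: FEk.
Qed.

End SinThetaPi.

(** * Resolvent set and spectrum *)

Section Neumann.
Variables (R : realType) (H : completeNormedModType R[i]).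
Implicit Types (x y z : H).

Lemma linear_inverse (T : {linear H -> H}) m : 0 < m ->
    (forall x, m * nrm x <= nrm (T x)) -> (forall y, exists x, T x = y) ->
  exists2 K : {linear H -> H}, continuous K &
    (forall x, K (T x) = x) /\ (forall x, T (K x) = x).
Proof.
move=> m0 Tm Tsurj; have [K0 TK] := choice Tsurj.
have Tinj x y : T x = T y -> x = y.
  move=> /eqP; rewrite -subr_eq0 -linearB => /eqP Txy; apply/eqP.
  rewrite -subr_eq0 -normr_eq0 nrmE; apply/eqP; congr (_%:C).
  have := Tm (x - y); rewrite Txy {2}/nrm normr0 /= => h.
  by apply/eqP; rewrite eq_le nrm_ge0 andbT -(ler_pM2l m0) mulr0.
have Klin : linear K0.
  by move=> a x y; apply: Tinj; rewrite linearP !TK.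
pose K : {linear H -> H} := HB.pack K0 (GRing.isLinear.Build _ _ _ _ K0 Klin).
exists K; last by split=> x; [apply: Tinj; rewrite TK | exact: TK].
apply: (@nrm_linear_continuous _ _ _ m^-1) => x.
by rewrite ler_pdivlMl// -{2}[x]TK; exact: Tm.
Qed.

Lemma cauchy_geometric (u : H ^nat) (q C : R) : 0 <= q < 1 -> 0 <= C ->
  (forall k, nrm (u k) <= C * q ^+ k) -> cvgn (series u).
Proof.
move=> /andP[q0 q1] C0 uq; apply/cauchy_cvgP/cauchy_seriesP => e e0.
move: e0; rewrite ltcE => /andP[/eqP/= ei e0].
have -> : e = (complex.Re e)%:C by case: e ei {e0} => a b /= ->.
move: (complex.Re e) e0 => {ei}{}e e0.
have tail n m : nrm (\sum_(n <= k < m) u k) <= C * q ^+ n / (1 - q).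
  have q1' : 0 < 1 - q by lra.
  have [nm|mn] := leqP n m; last first.
    rewrite big_geq ?(ltnW mn)// /nrm normr0 divr_ge0 ?mulr_ge0 ?exprn_ge0//.
    exact: ltW.
  rewrite -(subnKC nm); move: (m - n)%N => j.
  suff : nrm (\sum_(n <= k < n + j) u k) <= C * (q ^+ n - q ^+ (n + j)) / (1 - q).
    move=> /le_trans; apply; rewrite ler_pM2r ?invr_gt0//; apply: ler_wpM2l => //.
    by rewrite gerBl exprn_ge0.
  elim: j => [|j IH].
    by rewrite addn0 big_geq// /nrm normr0 subrr mulr0 mul0r.
  rewrite addnS big_nat_recr ?leq_addr//=.
  apply: le_trans (nrmD _ _) _; apply: le_trans (lerD IH (uq _)) _.
  rewrite exprS le_eqVlt; apply/orP; left; apply/eqP.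
  by field; rewrite lt0r_neq0.
have cv : (fun n => C / (1 - q) * q ^+ n) @ \oo --> (C / (1 - q) * 0).
  by apply: cvgMr; apply: cvg_expr; rewrite ger0_norm.
rewrite mulr0 in cv; have /cvgrPdist_lt/(_ e e0)[N _ NP] := cv.
exists ([set n | (N <= n)%N], [set n | (N <= n)%N]) => [|[n m] /= [Nn _]].
  by split; exists N.
rewrite nrmE ltcR; apply: le_lt_trans (tail n m) _.
have := NP n Nn; rewrite /= sub0r normrN; apply: le_lt_trans.
by rewrite mulrAC ler_norm.
Qed.

(** Sum the series of the [G^k y]. *)
Lemma neumann (G : {linear H -> H}) (q : R) : 0 <= q < 1 ->
    (forall x, nrm (G x) <= q * nrm x) ->
  forall y, exists x, x - G x = y.
Proof.
move=> q01 Gq y; pose u k := iter k G y.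
have uq k : nrm (u k) <= nrm y * q ^+ k.
  elim: k => [|k IH]; first by rewrite expr0 mulr1.
  apply: le_trans (Gq _) _; rewrite exprS mulrCA.
  by apply: ler_wpM2l IH; case/andP: q01.
have cu : cvgn (series u) := cauchy_geometric q01 (nrm_ge0 y) uq.
exists (limn (series u)).
have cG : continuous G := nrm_linear_continuous Gq.
have E n : series u n.+1 = y + G (series u n).
  rewrite /series /= linear_sum big_nat_recl//.
have c1 : series u n.+1 @[n --> \oo] --> y + G (limn (series u)).
  under eq_fun do rewrite E.
  apply: cvgD; first exact: cvg_cst.
  exact: (cvg_comp _ _ cu (cG _)).
have c2 : series u n.+1 @[n --> \oo] --> limn (series u).
  by rewrite (cvg_shiftS (series u)).
by rewrite {1}(cvg_unique _ c2 c1)//; rewrite addrK.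
Qed.

End Neumann.

Section Spectrum.
Variables (R : realType) (H : completeNormedModType R[i]).
Variable A : {linear H -> H}.
Hypothesis A_cont : continuous A.
Implicit Types (x y z : H) (c : R).

Definition real_resolvent : set R := [set c | resolvent_set A c%:C].

Lemma real_resolvent_lower c : real_resolvent c ->
  exists2 m, 0 < m & forall x, m * nrm x <= nrm (A x - c%:C *: x).
Proof.
move=> [K [cK KA _]]; have [C C0 KC] := continuous_linear_nrm cK.
exists (C + 1)^-1; first by rewrite invr_gt0; lra.
move=> x; rewrite ler_pdivrMl; last lra.
by rewrite -{1}(KA x); apply: le_trans (KC _) _; have := nrm_ge0 (A x - c%:C *: x); nra.
Qed.

Lemma real_resolventP c m : 0 < m ->
    (forall x, m * nrm x <= nrm (A x - c%:C *: x)) ->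
    (forall y, exists x, A x - c%:C *: x = y) ->
  real_resolvent c.
Proof.
move=> m0 Am Asurj.
pose T : {linear H -> H} := A \- ( *:%R c%:C : H -> H).
have [K cK [KT TK]] := @linear_inverse _ _ T m m0 Am Asurj.
by exists K; split.
Qed.

(** With [K] the inverse of [A - c], one has
    [(A - c') K = 1 - (c' - c) K], and the Neumann series inverts the right-hand
    side for [c'] near [c]. *)
Lemma open_real_resolvent : open real_resolvent.
Proof.
rewrite openE => c Rc; have [m m0 Am] := real_resolvent_lower Rc.
case: Rc => K [cK KA AK].
apply/nbhs_ballP; exists (m / 2) => /=; first lra.
move=> c'; rewrite /ball/= => cc'.
have AE x : A x - c'%:C *: x = (A x - c%:C *: x) + (c - c')%:C *: x.
  by rewrite rmorphB scalerBl addrA subrK.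
have lowc' x : m / 2 * nrm x <= nrm (A x - c'%:C *: x).
  have := Am x; have -> : A x - c%:C *: x = (A x - c'%:C *: x) + (c' - c)%:C *: x.
    by rewrite rmorphB scalerBl addrA subrK.
  move=> /le_trans/(_ (nrmD _ _)); rewrite nrmZ distrC.
  have := nrm_ge0 x; have : `|c - c'| < m / 2 by [].
  by nra.
apply: (real_resolventP _ lowc'); first lra.
move=> y.
pose G : {linear H -> H} := (c' - c)%:C \*: K.
have Gq x : nrm (G x) <= 2^-1 * nrm x.
  rewrite /G /= nrmZ distrC; have := Am (K x); rewrite AK.
  have := nrm_ge0 (K x); have : `|c - c'| < m / 2 by [].
  by have := normr_ge0 (c - c'); nra.
have h2 : (0 <= (2^-1 : R)) && ((2^-1 : R) < 1) by apply/andP; split; lra.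
have [x xE] := @neumann _ _ G _ h2 Gq y.
by exists (K x); rewrite AE AK -xE -opprB rmorphN scaleNr.
Qed.

(** [A - c = - c (1 - A / c)], which the Neumann series inverts for large [c]. *)
Lemma real_spectrum_bounded : exists L, forall c, L < `|c| -> real_resolvent c.
Proof.
have [C C0 AC] := continuous_linear_nrm A_cont.
exists (2 * C + 1) => c Lc; have c0 : 0 < `|c| by lra.
have c_neq0 : c != 0 by rewrite -normr_gt0.
apply: (@real_resolventP c (`|c| - C)); first lra.
  move=> x; rewrite mulrBl lerBlDl -nrmZ.
  have := nrmD (A x) (- (A x - c%:C *: x)).
  have -> : A x - (A x - c%:C *: x) = c%:C *: x by rewrite opprB addrC subrK.
  by rewrite nrmN => /le_trans; apply; apply: lerD.
move=> y; pose G : {linear H -> H} := c^-1%:C \*: A.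
have Gq x : nrm (G x) <= 2^-1 * nrm x.
  rewrite /G /= nrmZ normfV ler_pdivrMl//.
  by have := AC x; have := nrm_ge0 x; nra.
have h2 : (0 <= (2^-1 : R)) && ((2^-1 : R) < 1) by apply/andP; split; lra.
have [x xE] := @neumann _ _ G _ h2 Gq (- (c^-1%:C *: y)).
exists x; apply: (scalerI (_ : c^-1%:C != 0)).
  by rewrite -[0]/(0%:C) (inj_eq (@complexI _)) invr_eq0.
rewrite -[RHS]opprK -xE scalerBr scalerA -rmorphM mulVf// scale1r.
by rewrite opprB.
Qed.

End Spectrum.

(** * Perturbation of the spectrum *)

Section Support.
Variables (R : realType) (H : completeNormedModType R[i]).
Variable dot : {dot H for Num.conj}.
Hypothesis dot_norm : norm_from_dot dot.
Variables (A B : {linear H -> H}) (E F : set R -> {linear H -> H}) (v : R).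
Hypothesis A_sym : forall x y, dot (A x) y = dot x (A y).
Hypothesis B_sym : forall x y, dot (B x) y = dot x (B y).
Hypothesis AE : spectral_measure dot A E.
Hypothesis BF : spectral_measure dot B F.
Hypothesis ABv : forall x, nrm (B x - A x) <= v * nrm x.
Implicit Types (D S T : set R) (x y z : H).

Lemma itv_dist (c r t : R) : `]c - r, c + r[%classic t <-> `|t - c| < r.
Proof. by rewrite /= in_itv/= ltr_distl. Qed.

Lemma spectral_support D x : measurable D -> D `<=` real_resolvent A ->
  E D x = 0.
Proof.
move=> mD DR; apply: (spectral_locally0 dot_norm AE mD) => t /DR.
move=> /real_resolvent_lower[m m0 Am]; exists (m / 2); first lra.
set I := `]_, _[%classic; have mI : measurable I by exact: measurable_itv.
apply: (nrm_eq0 dot_norm); apply/eqP; rewrite eq_le nrm_ge0 andbT.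
have It s : I s -> `|s - t| <= m / 2 by move=> /itv_dist/ltW.
have := spectral_norm_le dot_norm A_sym AE x mI It.
by move=> /(le_trans (Am _)); nra.
Qed.

Lemma resolvent_lower_dist c r x : (forall s, `|s - c| < r -> real_resolvent A s) ->
  r * nrm x <= nrm (A x - c%:C *: x).
Proof.
move=> rR; set I := `]c - r, c + r[%classic.
have mI : measurable I by exact: measurable_itv.
have mIC := measurableC mI.
have xE : E (~` I) x = x.
  rewrite (spectralC dot_norm AE)// spectral_support ?subr0// => s /itv_dist.
  exact: rR.
have Is s : (~` I) s -> r <= `|s - c|.
  by move=> Is; rewrite leNgt; apply/negP => /itv_dist.
by have := spectral_norm_ge dot_norm A_sym AE x mIC Is; rewrite xE.
Qed.

(** A perturbation of norm [v] moves the spectrum by at most [v]: for [u] in the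
    range of [F] of a small interval around [t], [|(B - t) u|] is small, while
    [|(B - t) u| >= |(A - t) u| - v |u| >= (r - v) |u|]. *)
Lemma perturbed_support D x : measurable D ->
    (forall t, D t -> exists2 r, v < r &
       forall s, `|s - t| < r -> real_resolvent A s) ->
  F D x = 0.
Proof.
move=> mD DR; apply: (spectral_locally0 dot_norm BF mD) => t /DR[r vr rR].
exists ((r - v) / 2); first lra.
set I := `]_, _[%classic; have mI : measurable I by exact: measurable_itv.
have It s : I s -> `|s - t| <= (r - v) / 2 by move=> /itv_dist/ltW.
apply: (nrm_eq0 dot_norm); apply/eqP; rewrite eq_le nrm_ge0 andbT.
have h1 := spectral_norm_le dot_norm B_sym BF x mI It.
have h2 := resolvent_lower_dist (F I x) rR.
have h3 := ABv (F I x).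
have h4 := nrmD (B (F I x) - t%:C *: F I x) (- (B (F I x) - A (F I x))).
move: h4; rewrite nrmN opprB addrC addrA subrK => h4.
suff : (r - v) / 2 * nrm (F I x) <= 0 by nra.
lra.
Qed.

End Support.

Section Separation.
Variables (R : realType) (H : completeNormedModType R[i]).
Variable dot : {dot H for Num.conj}.
Hypothesis dot_norm : norm_from_dot dot.
Variables (A B : {linear H -> H}) (E F : set R -> {linear H -> H}) (v d : R).
Hypothesis A_cont : continuous A.
Hypothesis B_cont : continuous B.
Hypothesis A_sym : forall x y, dot (A x) y = dot x (A y).
Hypothesis B_sym : forall x y, dot (B x) y = dot x (B y).
Hypothesis AE : spectral_measure dot A E.
Hypothesis BF : spectral_measure dot B F.
Hypothesis v_ge0 : 0 <= v.
Hypothesis v_lt : v < d / 2.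
Hypothesis ABv : forall x, nrm (B x - A x) <= v * nrm x.

(** The bound [r] is uniform in [S]: the condition [v < |s - t|] for each [s]
    would allow points of [S] whose distances to [t] decrease to [v]. *)
Definition away (S T : set R) := forall t, T t ->
  exists2 r, v < r & forall s, S s -> r <= `|s - t|.

Variables S1 S2 T1 T2 : set R.
Hypotheses (mS1 : measurable S1) (mS2 : measurable S2).
Hypotheses (mT1 : measurable T1) (mT2 : measurable T2).
Hypothesis specA : ~` (S1 `|` S2) `<=` real_resolvent A.
Hypothesis gap : forall s t, S1 s -> S2 t -> d <= `|s - t|.
Hypothesis T1S2 : away S2 T1.
Hypothesis T2S1 : away S1 T2.

Let dv_gt0 : 0 < d - v.
Proof. by move: v_ge0 v_lt; lra. Qed.

Lemma away_null D x : measurable D -> away S1 D -> away S2 D -> F D x = 0.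
Proof.
move=> mD D1 D2; apply: (perturbed_support dot_norm A_sym B_sym AE BF ABv x mD).
move=> t Dt; have [r1 vr1 r1S] := D1 t Dt; have [r2 vr2 r2S] := D2 t Dt.
exists (Num.min r1 r2); first by rewrite lt_min vr1.
move=> s; rewrite lt_min => /andP[s1 s2]; apply: specA => -[/r1S|/r2S].
  by rewrite leNgt s1.
by rewrite leNgt s2.
Qed.

Lemma spectral_drop T U x : measurable T -> measurable U ->
  F (T `&` U) x = 0 -> F T x = F (T `&` ~` U) x.
Proof.
move=> mT mU TU0; rewrite -{1}[T]setIT -(setUv U) setIUr.
rewrite (spectralU dot_norm BF) ?TU0 ?add0r//.
- exact: measurableI.
- by apply: measurableI => //; exact: measurableC.
- by rewrite setIACA setICr setI0.
Qed.

Lemma open_fattening (S : set R) r : open (\bigcup_(s in S) ball s r).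
Proof. by apply: bigcup_open => s _; exact: ball_open. Qed.

(** The part of [T2] within [d - v] of [S1] is farther than [v] from both [S1]
    and [S2], hence null for [F]. *)
Lemma sin_theta_pi x :
  nrm (E S1 (F T2 x)) <= pi / 2 * (v / (d - v)) * nrm x.
Proof.
pose U := \bigcup_(s in S1) ball s (d - v).
have mU : measurable U by apply: open_measurable; exact: open_fattening.
rewrite (spectral_drop mT2 mU).
  apply: (bhatia_davis_mcintosh dot_norm A_cont B_cont A_sym B_sym AE BF) => //.
  - by apply: measurableI => //; exact: measurableC.
  - move=> s t S1s [_ Ut]; rewrite leNgt; apply/negP => st; apply: Ut.
    by exists s.
apply: away_null; first exact: measurableI.
- by move=> t [T2t _]; exact: T2S1.
- move=> t [_ [s S1s st]]; exists (d - `|s - t|).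
    by move: st; rewrite /ball/=; lra.
  move=> s' S2s'; rewrite lerBlDr; apply: le_trans (gap S1s S2s') _.
  by rewrite [leRHS]addrC [X in _ <= _ + X]distrC; exact: ler_distD.
Qed.

Section Interval.
Variables a b : R.
Hypothesis ab : a <= b.
Hypothesis S1_itv : forall s, S1 s -> a <= s <= b.
Hypothesis S2_out : forall s, S2 s -> s <= a - d \/ b + d <= s.

(** The points of [T2] within [d - v] of the interval [[a, b]] are farther than
    [v] from both [S1] and [S2], hence null for [F]. *)
Lemma sin_theta_in x : nrm (E S1 (F T2 x)) <= v / (d - v) * nrm x.
Proof.
pose U := `]a - (d - v), b + (d - v)[%classic.
have mU : measurable U by exact: measurable_itv.
rewrite (spectral_drop mT2 mU); last first.
  apply: away_null; first exact: measurableI.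
  - by move=> t [T2t _]; exact: T2S1.
  - move=> t [_]; rewrite /U /= in_itv/= => /andP[t1 t2].
    exists (Num.min (t - (a - d)) (b + d - t)).
      by rewrite lt_min; apply/andP; split; lra.
    move=> s /S2_out[] h; rewrite ge_min !ler_normr; apply/orP; [left|right]; apply/orP; [right|left]; lra.
have mT : measurable (T2 `&` ~` U) by apply: measurableI => //; exact: measurableC.
apply: (projections_adjoint_le dot_norm AE BF) => //.
  by rewrite divr_ge0// ltW.
move=> y; apply: (davis_kahan dot_norm A_sym B_sym AE BF v_ge0 ABv
  (c := (a + b) / 2) (r := (b - a) / 2)) => //; try by move: ab; lra.
- by move=> t /S1_itv/andP[h1 h2]; rewrite ler_norml; apply/andP; split; lra.
- move=> t [_]; rewrite /U /= in_itv/= => /negP; rewrite negb_and -!leNgt.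
  by rewrite ler_normr => /orP[] h; apply/orP; [right|left]; lra.
Qed.

(** Here [T1], the part near [S1], reduces to a subset of [[a - v, b + v]], and
    the roles of [A] and [B] are exchanged. *)
Lemma sin_theta_out x : nrm (E S2 (F T1 x)) <= v / (d - v) * nrm x.
Proof.
pose U := ~` `[a - v, b + v]%classic.
have mU : measurable U by apply: measurableC; exact: measurable_itv.
rewrite (spectral_drop mT1 mU); last first.
  apply: away_null; first exact: measurableI.
  - move=> t [_]; rewrite /U /= in_itv/= => /negP; rewrite negb_and -!ltNge => h.
    exists (Num.max (a - t) (t - b)).
      by rewrite lt_max; move: h => /orP[] h; apply/orP; [left|right]; lra.
    move=> s /S1_itv/andP[s1 s2]; rewrite ge_max !ler_normr.
    by apply/andP; split; apply/orP; [left|right]; lra.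
  - by move=> t [T1t _]; exact: T1S2.
have mT : measurable (T1 `&` ~` U) by apply: measurableI => //; exact: measurableC.
have BAv z : nrm (A z - B z) <= v * nrm z by rewrite -nrmN opprB.
apply: (davis_kahan dot_norm B_sym A_sym BF AE v_ge0 BAv
  (c := (a + b) / 2) (r := (b - a) / 2 + v)) => //; try by move: ab v_ge0; lra.
- move=> t [_]; rewrite /U setCK /= in_itv/= => /andP[h1 h2].
  by rewrite ler_norml; apply/andP; split; lra.
- by move=> t /S2_out[] h; rewrite ler_normr; apply/orP; [right|left]; lra.
Qed.

End Interval.
End Separation.

(** * Comparison of the two projections *)

Section ProjectionsClose.
Variables (R : realType) (H : normedModType R[i]) (dot : {dot H for Num.conj}).
Hypothesis dot_norm : norm_from_dot dot.
Variables (A B : {linear H -> H}) (E F : set R -> {linear H -> H}).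
Hypothesis AE : spectral_measure dot A E.
Hypothesis BF : spectral_measure dot B F.

(** [P - Q = P (1 - Q) - (1 - P) Q], where the two terms have orthogonal ranges
    and live on the orthogonal ranges of [1 - Q] and [Q]. *)
Lemma nrm_sub_projections S T k x : measurable S -> measurable T ->
    (forall x, nrm (E S (F (~` T) x)) <= k * nrm x) ->
    (forall x, nrm (E (~` S) (F T x)) <= k * nrm x) -> 0 <= k ->
  nrm (E S x - F T x) <= k * nrm x.
Proof.
move=> mS mT h1 h2 k0; have mSC := measurableC mS; have mTC := measurableC mT.
have -> : E S x - F T x = E S (F (~` T) x) - E (~` S) (F T x).
  rewrite (spectralC dot_norm BF)// (spectralC dot_norm AE)// linearB /=.
  by rewrite opprB addrA subrK.
rewrite -(ler_pXn2r (n := 2)) ?nnegrE ?mulr_ge0 ?nrm_ge0//.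
have o := spectral_orth dot_norm AE (F (~` T) x) (F T x) mS mSC (setICr S).
rewrite exprMn {1}(nrm_sqr dot_norm) !(ipBl, ipBr).
rewrite (ipC _ (E (~` S) _) (E S _)) o.
rewrite -!(nrm_sqr dot_norm).
have -> : nrm x ^+ 2 = nrm (F T x) ^+ 2 + nrm (F (~` T) x) ^+ 2.
  rewrite !(spectral_sqr dot_norm BF)// (spectralC dot_norm BF)// ipBl.
  by rewrite (nrm_sqr dot_norm) addrC subrK.
have b1 : nrm (E S (F (~` T) x)) ^+ 2 <= k ^+ 2 * nrm (F (~` T) x) ^+ 2.
  rewrite -exprMn ler_pXn2r ?nnegrE ?mulr_ge0 ?nrm_ge0//.
  by rewrite -{1}(spectral_idem BF)//; exact: h1.
have b2 : nrm (E (~` S) (F T x)) ^+ 2 <= k ^+ 2 * nrm (F T x) ^+ 2.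
  rewrite -exprMn ler_pXn2r ?nnegrE ?mulr_ge0 ?nrm_ge0//.
  by rewrite -{1}(spectral_idem BF)//; exact: h2.
rewrite mulrDr subr0 sub0r opprK addrC; exact: lerD.
Qed.

End ProjectionsClose.

Section RealSets.
Variable R : realType.
Implicit Types S T : set R.

Lemma dist_gap S T s t : S s -> T t -> dist S T <= `|s - t|.
Proof.
move=> Ss Tt; apply: ge_inf; last by exists s => //; exists t.
by exists 0 => _ [x _ [y _ <-]].
Qed.

Lemma nbhdE eps S : S !=set0 -> nbhd eps S = \bigcup_(s in S) ball s eps.
Proof.
move=> S0; apply/seteqP; split=> t.
  rewrite /nbhd /dist /= => /inf_lt[|_ [_ -> [s Ss <-]] ts].
    by case: S0 => s Ss; exists `|t - s|; exists t => //; exists s.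
  by exists s => //; rewrite /ball /= distrC.
move=> [s Ss ts]; rewrite /nbhd /=.
by apply: le_lt_trans (dist_gap (erefl t) Ss) _; rewrite distrC.
Qed.

Lemma conv_hull_between S s t u : S s -> S t -> s <= u <= t -> conv_hull S u.
Proof.
move=> Ss St /andP[su ut] C [/= Cc SC].
have [st|st] := eqVneq s t; first by apply: SC; rewrite (_ : u = s)//; lra.
have st0 : 0 < t - s by rewrite subr_gt0 lt_neqAle st; lra.
have l0 : 0 <= (t - u) / (t - s) by rewrite divr_ge0 ?(ltW st0) ?subr_ge0.
have l1 : (t - u) / (t - s) <= 1 by rewrite ler_pdivrMr// mul1r; lra.
have := Cc s t (Itv01 l0 l1) (mem_set (SC _ Ss)) (mem_set (SC _ St)).
move=> /set_mem; congr (C _).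
rewrite -[LHS]/((t - u) / (t - s) * s + (1 - (t - u) / (t - s)) * t).
by field; rewrite lt0r_neq0.
Qed.

(** A point of [T] between two points of [S] would lie in the convex hull, so
    each point of [T] is on one side of all of [S], at distance [d] at least
    from each of its points and hence from the nearer bound of [S]. *)
Lemma conv_hull_separation S T d : S !=set0 -> 0 < d ->
    (exists L, forall s, S s -> `|s| <= L) ->
    (forall s t, S s -> T t -> d <= `|s - t|) -> conv_hull S `&` T = set0 ->
  exists a b, [/\ a <= b, forall s, S s -> a <= s <= b &
                  forall t, T t -> t <= a - d \/ b + d <= t].
Proof.
move=> S0 d0 [L SL] gap hull0.
have hasl : has_lbound S by exists (- L) => s /SL; rewrite ler_norml => /andP[].
have hasu : has_ubound S by exists L => s /SL; rewrite ler_norml => /andP[].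
have Sab s : S s -> inf S <= s <= sup S.
  by move=> Ss; apply/andP; split; [exact: ge_inf | exact: ub_le_sup].
exists (inf S), (sup S); split=> //.
  by case: S0 => s /Sab/andP[]; exact: le_trans.
move=> t Tt; have [[s Ss st]|none] := pselect (exists2 s, S s & s <= t).
  right; rewrite -lerBrDr; apply: ge_sup => // s' Ss'.
  have [ts'|s't] := leP t s'.
    suff : (conv_hull S `&` T) t by rewrite hull0.
    by split=> //; apply: (conv_hull_between Ss Ss'); rewrite st.
  by have := gap _ _ Ss' Tt; rewrite ltr0_norm ?subr_lt0//; lra.
left; rewrite lerBrDr; apply: lb_le_inf => // s Ss.
have [st|ts] := leP s t; first by case: none; exists s.
by have := gap _ _ Ss Tt; rewrite gtr0_norm ?subr_gt0//; lra.
Qed.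

End RealSets.

(** A point outside [S] is either in [T], and then its ball of radius [d] avoids
    [S], or in the resolvent set [U].  This makes the parts of the spectrum
    closed, hence Borel. *)
Lemma open_spectral_part_compl (R : realType) (S T U : set R) (d : R) :
    open U -> (forall s, U s -> ~ S s) -> ~` (S `|` T) `<=` U -> 0 < d ->
    (forall s t, S s -> T t -> d <= `|s - t|) ->
  open (~` S).
Proof.
move=> oU US STU d0 gap; rewrite openE => t St.
have [Tt|Tt] := pselect (T t).
  apply/nbhs_ballP; exists d => //= s; rewrite /ball/= => ts Ss.
  by have := gap _ _ Ss Tt; rewrite distrC leNgt ts.
have Ut : U t by apply: STU => -[].
by apply: filterS (open_nbhs_nbhs (conj oU Ut)) => s /US.
Qed.

Theorem theorem1 (R : realType) (H : completeNormedModType R[i])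
    (dot : {dot H for Num.conj})
    (dot_norm : norm_from_dot dot) (H_separable : separable H)
    (A V : {linear H -> H})
    (A_sa : bounded_selfadjoint dot A) (V_sa : bounded_selfadjoint dot V)
    (sigma Sigma : set R) (sigma0 : sigma !=set0) (Sigma0 : Sigma !=set0)
    (d : R)
    (spec_A : spec A = (fun t : R => t%:C) @` (sigma `|` Sigma))
    (dist_d : dist sigma Sigma = d) (d_gt0 : 0 < d)
    (P Q : {linear H -> H})
    (P_def : spectral_projection dot A sigma P)
    (Q_def : spectral_projection dot (A \+ V) (nbhd (d / 2) sigma) Q)
    (V_small :
      opnorm V < 2 / (2 + pi) * d \/
      (opnorm V < 1 / 2 * d /\
       (conv_hull sigma `&` Sigma = set0 \/ conv_hull Sigma `&` sigma = set0))) :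
  opnorm (P \- Q) < 1.
Proof.
have [cA symA] := A_sa; have [cV symV] := V_sa.
have [E AE PE] := P_def; have [F BF QF] := Q_def.
pose B : {linear H -> H} := A \+ V; rewrite -/B in BF.
have cB : continuous B by move=> x; apply: continuousD; [exact: cA | exact: cV].
have symB x y : dot (B x) y = dot x (B y).
  rewrite /B /= linearDl linearDr; congr (_ + _); [exact: symA|exact: symV].
pose v := opnorm V; have v0 : 0 <= v := opnorm_ge0 cV.
have ABv x : nrm (B x - A x) <= v * nrm x.
  by rewrite /B /= addrC addKr; exact: nrm_opnorm.
have pi2 := pi_ge2 R.
have pi2_gt0 : 0 < 2 + pi :> R by lra.
have v_lt : v < d / 2.
  case: V_small => [h|[h _]]; last by rewrite /v; lra.
  apply: lt_le_trans h _; rewrite mulrAC ler_pdivrMr//; nra.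
have dv0 : 0 < d - v by lra.
have specP s : (sigma `|` Sigma) s <-> ~ real_resolvent A s.
  have -> : (~ real_resolvent A s) = spec A s%:C by [].
  rewrite spec_A; split=> [ss|[t tS /complexI <-//]]; by exists s.
have specA : ~` (sigma `|` Sigma) `<=` real_resolvent A.
  by move=> s Ss; apply: contrapT => /specP.
have specA' : ~` (Sigma `|` sigma) `<=` real_resolvent A by rewrite setUC.
have gap s t : sigma s -> Sigma t -> d <= `|s - t|.
  by rewrite -dist_d; exact: dist_gap.
have gap' s t : Sigma s -> sigma t -> d <= `|s - t|.
  by move=> Ss st; rewrite distrC; exact: gap.
have oR := @open_real_resolvent R H A.
have mS : measurable sigma.
  rewrite -[sigma]setCK; apply: measurableC; apply: open_measurable.
  apply: open_spectral_part_compl oR _ specA d_gt0 gap => s Rs ss.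
  by apply: (specP s).1 Rs; left.
have mS' : measurable Sigma.
  rewrite -[Sigma]setCK; apply: measurableC; apply: open_measurable.
  apply: open_spectral_part_compl oR _ specA' d_gt0 gap' => s Rs ss.
  by apply: (specP s).1 Rs; right.
have [L RL] := real_spectrum_bounded cA.
have bnd s : (sigma `|` Sigma) s -> `|s| <= L.
  by move=> /specP Rs; rewrite leNgt; apply/negP => /RL.
pose N := nbhd (d / 2) sigma; rewrite -/N in QF.
have NE : N = \bigcup_(s in sigma) ball s (d / 2) := nbhdE _ sigma0.
have mN : measurable N by rewrite NE; apply: open_measurable; exact: open_fattening.
have mNC := measurableC mN.
(* a point of N is within d / 2 of sigma, hence not of Sigma *)
have awayN : away v Sigma N.
  rewrite NE => t [s ss st]; exists (d / 2) => // s' Ss'.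
  have h1 := gap _ _ ss Ss'; have h2 := ler_distD t s s'.
  by move: st h2; rewrite /ball/= (distrC t s'); lra.
have awayNC : away v sigma (~` N).
  rewrite NE => t Nt; exists (d / 2) => // s ss.
  by rewrite leNgt; apply/negP => st; apply: Nt; exists s.
have [k [k0 k1 h1 h2]] : exists k, [/\ 0 <= k, k < 1,
    forall x, nrm (E sigma (F (~` N) x)) <= k * nrm x &
    forall x, nrm (E Sigma (F N x)) <= k * nrm x].
  case: V_small => [vs|[_ hull]].
    exists (pi / 2 * (v / (d - v))); split.
    - by rewrite mulr_ge0 ?divr_ge0// ?ltW//; lra.
    - rewrite mulrA ltr_pdivrMr//; move: vs; rewrite mulrAC ltr_pdivlMr// -/v; nra.
    - by move=> x; apply: (sin_theta_pi dot_norm cA cB symA symB AE BF v0 v_lt ABv mS mNC specA).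
    - by move=> x; apply: (sin_theta_pi dot_norm cA cB symA symB AE BF v0 v_lt ABv mS' mN specA').
  have k0 : 0 <= v / (d - v) by rewrite divr_ge0// ltW.
  have k1 : v / (d - v) < 1 by rewrite ltr_pdivrMr//; lra.
  exists (v / (d - v)); case: hull => hull.
    have bnd_sigma : exists L, forall s, sigma s -> `|s| <= L.
      by exists L => s ss; apply: bnd; left.
    have [a [b [ab inab outab]]] := conv_hull_separation sigma0 d_gt0 bnd_sigma gap hull.
    split=> // x.
      by apply: (sin_theta_in dot_norm symA symB AE BF v0 v_lt ABv mS mNC specA
        awayNC ab inab outab).
    by apply: (sin_theta_out dot_norm symA symB AE BF v0 v_lt ABv mS' mN specA
      awayN ab inab outab).
  have bnd_Sigma : exists L, forall s, Sigma s -> `|s| <= L.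
    by exists L => s ss; apply: bnd; right.
  have [a [b [ab inab outab]]] := conv_hull_separation Sigma0 d_gt0 bnd_Sigma gap' hull.
  split=> // x.
    by apply: (sin_theta_out dot_norm symA symB AE BF v0 v_lt ABv mS mNC specA'
      awayNC ab inab outab).
  by apply: (sin_theta_in dot_norm symA symB AE BF v0 v_lt ABv mS' mN specA'
    awayN ab inab outab).
have PQ x : nrm ((P \- Q) x) <= k * nrm x.
  rewrite /= PE QF; apply: (nrm_sub_projections dot_norm AE BF) => // y.
  (* the spectrum outside sigma is Sigma *)
  suff -> : E (~` sigma) (F N y) = E Sigma (F N y) by [].
  rewrite (spectral_drop dot_norm AE (measurableC mS) (measurableC mS')).
    rewrite setCK; congr (E _ _); apply/setIidr => t St st.
    by have := gap _ _ st St; rewrite subrr normr0; lra.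
  apply: (spectral_support dot_norm symA AE).
    by apply: measurableI; exact: measurableC.
  by rewrite -setCU.
by apply: le_lt_trans k1; exact: opnorm_le.
Qed.
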